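(* There is a combinatorial polynomial-time $5$-approximation algorithm for the Robust Matroid Center problem. That is, given an instance $((X,d),w,M,m)$ of Robust Matroid Center that admits a feasible solution, the algorithm outputs a set $C\in\mathcal{I}$ and a radius $r'$ with $w(B(C,r'))\ge m$ and $r'\le 5\,r^*$, where $r^*$ is the optimal radius of the instance.
   Context: For a finite metric space $(X,d)$, $u\in X$ and $r\ge 0$, let $B(u,r)=\{v\in X: d(u,v)\le r\}$, and for $U\subseteq X$ let $B(U,r)=\bigcup_{u\in U}B(u,r)$. For $w\colon X\to\mathbb{R}_{\ge 0}$ and $U\subseteq X$, $w(U)=\sum_{u\in U}w(u)$. Robust Matroid Center: given a finite metric space $(X,d)$, weights $w\colon X\to\mathbb{R}_{\ge0}$, a matroid $M=(X,\mathcal{I})$ given by an independence oracle, and a number $m\in\mathbb{R}_{\ge0}$, find the smallest $r\in\mathbb{R}_{\ge 0}$ together with a set $C\subseteq X$ such that $C\in\mathcal{I}$ and $w(B(C,r))\ge m$. The optimal radius $r^*$ is this smallest $r$. Running time is measured with independence-oracle calls counted as unit operations. *)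

(* Defs.v *)
From HB Require Import structures.
From mathcomp Require Import all_boot all_order all_algebra reals.

Set Implicit Arguments.
Unset Strict Implicit.
Unset Printing Implicit Defensive.

Import Order.TTheory GRing.Theory Num.Theory.
Local Open Scope ring_scope.

Definition is_metric (R : realType) (X : Type) (d : X -> X -> R) : Prop :=
  [/\ forall x y, 0 <= d x y,
      forall x y, d x y = 0 <-> x = y,
      forall x y, d x y = d y x &
      forall x y z, d x z <= d x y + d y z].

Definition is_matroid (X : finType) (I : {set {set X}}) : Prop :=
  [/\ set0 \in I,
      forall A B : {set X}, A \subset B -> B \in I -> A \in I &
      forall A B : {set X}, A \in I -> B \in I -> (#|A| < #|B|)%N ->
        exists2 x, x \in B :\: A & x |: A \in I].

Record rmc_instance (R : realType) := RmcInstance {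
  points : finType;
  dist : points -> points -> R;
  dist_metric : is_metric dist;
  weight : points -> R;
  weight_ge0 : forall u, 0 <= weight u;
  indep : {set {set points}};
  indep_matroid : is_matroid indep;
  target : R;
  target_ge0 : 0 <= target }.

Section Problem.
Variables (R : realType) (P : rmc_instance R).

Definition cball (u : points P) (r : R) : {set points P} :=
  [set v | dist u v <= r].

Definition cballs (U : {set points P}) (r : R) : {set points P} :=
  \bigcup_(u in U) cball u r.

Definition set_weight (U : {set points P}) : R := \sum_(u in U) weight u.

Definition feasible (C : {set points P}) (r : R) : Prop :=
  [/\ 0 <= r, C \in indep P & target P <= set_weight (cballs C r)].

Definition optimal_radius (r : R) : Prop :=
  (exists C, feasible C r) /\ (forall r' C, feasible C r' -> r <= r').

End Problem.

(* A uniform unit-cost random access machine over the reals with an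
   independence oracle.  A program is a finite piece of syntax, fixed once and
   for all, before the instance, its size and the field [R] are known.  Memory
   consists of finitely many (per program) arrays of naturals and arrays of
   reals; an array is named by a constant and indexed by a computed natural,
   and a scalar variable is cell 0 of an array.

   The only arithmetic is addition and subtraction, on naturals as well as on
   reals; the only real constant is 0, and reals influence control flow and
   naturals only through [<=].  Multiplication and integer part are left out
   on purpose: with those, unit cost would no longer be a realistic measure,
   as exponentially long numbers could be manipulated in polynomially many
   steps.  For rational data, the numbers occurring in a run of [t] steps have
   bit length polynomial in [t] and in the input length. *)

Inductive nexp : Type :=
  | NConst of nat
  | NSize                         (* number of points *)
  | NGet of nat & nexp            (* NGet a e : cell e of natural array a *)
  | NAdd of nexp & nexp
  | NSub of nexp & nexp.          (* truncated *)

Inductive rexp : Type :=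
  | RZero
  | RDist of nexp & nexp          (* distance of the points numbered e1, e2 *)
  | RWeight of nexp               (* weight of the point numbered e *)
  | RTarget
  | RGet of nat & nexp            (* RGet a e : cell e of real array a *)
  | RAdd of rexp & rexp
  | RSub of rexp & rexp.

Inductive bexp : Type :=
  | BLeN of nexp & nexp
  | BLeR of rexp & rexp
  | BIndep of nat                 (* oracle call on the set stored in array a *)
  | BNot of bexp
  | BAnd of bexp & bexp.

Inductive cmd : Type :=
  | Skip
  | NSet of nat & nexp & nexp     (* NSet a e1 e2 : a[e1] := e2 *)
  | RSet of nat & nexp & rexp     (* RSet a e1 e2 : a[e1] := e2 *)
  | Seq of cmd & cmd
  | If of bexp & cmd & cmd
  | While of bexp & cmd.

(* Evaluation costs: one unit per syntax node, an oracle call being one node. *)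
Fixpoint ncost (e : nexp) : nat :=
  match e with
  | NConst _ | NSize => 1
  | NGet _ e1 => (ncost e1).+1
  | NAdd e1 e2 | NSub e1 e2 => (ncost e1 + ncost e2).+1
  end.

Fixpoint rcost (e : rexp) : nat :=
  match e with
  | RZero | RTarget => 1
  | RWeight e1 | RGet _ e1 => (ncost e1).+1
  | RDist e1 e2 => (ncost e1 + ncost e2).+1
  | RAdd e1 e2 | RSub e1 e2 => (rcost e1 + rcost e2).+1
  end.

Fixpoint bcost (e : bexp) : nat :=
  match e with
  | BLeN e1 e2 => (ncost e1 + ncost e2).+1
  | BLeR e1 e2 => (rcost e1 + rcost e2).+1
  | BIndep _ => 1
  | BNot e1 => (bcost e1).+1
  | BAnd e1 e2 => (bcost e1 + bcost e2).+1
  end.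

Record state (R : realType) := State {
  nmem : nat -> nat -> nat;       (* nmem s a i : cell i of natural array a *)
  rmem : nat -> nat -> R }.

Definition init_state (R : realType) : state R :=
  State (fun _ _ => 0%N) (fun _ _ => 0).

Definition update (T : Type) (f : nat -> nat -> T) (a i : nat) (v : T) :
    nat -> nat -> T :=
  fun b j => if (b == a) && (j == i) then v else f b j.

Section Semantics.
Variables (R : realType) (P : rmc_instance R).

(* The program sees the points through their numbers 0, ..., #|points P| - 1;
   reading the data of a point that does not exist yields 0. *)
Definition point_nr (i : nat) : option (points P) := onth (enum (points P)) i.

Definition dist_nr (i j : nat) : R :=
  if (point_nr i, point_nr j) is (Some x, Some y) then dist x y else 0.

Definition weight_nr (i : nat) : R :=
  if point_nr i is Some x then weight x else 0.

(* The set of points stored in an array: those whose cell is nonzero. *)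
Definition array_set (f : nat -> nat) : {set points P} :=
  [set x | f (enum_rank x) != 0%N].

Fixpoint neval (s : state R) (e : nexp) : nat :=
  match e with
  | NConst k => k
  | NSize => #|points P|
  | NGet a e1 => nmem s a (neval s e1)
  | NAdd e1 e2 => (neval s e1 + neval s e2)%N
  | NSub e1 e2 => (neval s e1 - neval s e2)%N
  end.

Fixpoint reval (s : state R) (e : rexp) : R :=
  match e with
  | RZero => 0
  | RDist e1 e2 => dist_nr (neval s e1) (neval s e2)
  | RWeight e1 => weight_nr (neval s e1)
  | RTarget => target P
  | RGet a e1 => rmem s a (neval s e1)
  | RAdd e1 e2 => reval s e1 + reval s e2
  | RSub e1 e2 => reval s e1 - reval s e2
  end.

Fixpoint beval (s : state R) (e : bexp) : bool :=
  match e with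
  | BLeN e1 e2 => (neval s e1 <= neval s e2)%N
  | BLeR e1 e2 => reval s e1 <= reval s e2
  | BIndep a => array_set (nmem s a) \in indep P
  | BNot e1 => ~~ beval s e1
  | BAnd e1 e2 => beval s e1 && beval s e2
  end.

(* [exec c s s' t]: started in s, the command c halts in s' after t steps. *)
Inductive exec : cmd -> state R -> state R -> nat -> Prop :=
  | ExecSkip s : exec Skip s s 1
  | ExecNSet s a e1 e2 :
      exec (NSet a e1 e2) s
        (State (update (nmem s) a (neval s e1) (neval s e2)) (rmem s))
        (ncost e1 + ncost e2).+1
  | ExecRSet s a e1 e2 :
      exec (RSet a e1 e2) s
        (State (nmem s) (update (rmem s) a (neval s e1) (reval s e2)))
        (ncost e1 + rcost e2).+1
  | ExecSeq c1 c2 s1 s2 s3 t1 t2 :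
      exec c1 s1 s2 t1 -> exec c2 s2 s3 t2 ->
      exec (Seq c1 c2) s1 s3 (t1 + t2).+1
  | ExecIfTrue b c1 c2 s s' t :
      beval s b -> exec c1 s s' t -> exec (If b c1 c2) s s' (bcost b + t).+1
  | ExecIfFalse b c1 c2 s s' t :
      ~~ beval s b -> exec c2 s s' t -> exec (If b c1 c2) s s' (bcost b + t).+1
  | ExecWhileTrue b c s1 s2 s3 t1 t2 :
      beval s1 b -> exec c s1 s2 t1 -> exec (While b c) s2 s3 t2 ->
      exec (While b c) s1 s3 (bcost b + t1 + t2).+1
  | ExecWhileFalse b c s :
      ~~ beval s b -> exec (While b c) s s (bcost b).+1.

Lemma exec_det c s s1 s2 t1 t2 :
  exec c s s1 t1 -> exec c s s2 t2 -> s1 = s2 /\ t1 = t2.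
Proof.
move=> E1; elim: E1 s2 t2 => {c s s1 t1};
  try by intros; match goal with E : exec _ _ _ _ |- _ => inversion E end.
- move=> c1 c2 s1 s2 s3 t1 t2 _ IH1 _ IH2 s' t' E.
  inversion E as [| | |? ? ? ? ? ? ? E1 E2| | | |]; subst.
  by have [? ?] := IH1 _ _ E1; subst; have [-> ->] := IH2 _ _ E2.
- move=> b c1 c2 s s1 t1 hb _ IH s' t' E.
  inversion E as [| | | |? ? ? ? ? ? _ E1|? ? ? ? ? ? nb _| |]; subst.
    by have [-> ->] := IH _ _ E1.
  by rewrite hb in nb.
- move=> b c1 c2 s s1 t1 nb _ IH s' t' E.
  inversion E as [| | | |? ? ? ? ? ? hb _|? ? ? ? ? ? _ E1| |]; subst.
    by rewrite hb in nb.
  by have [-> ->] := IH _ _ E1.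
- move=> b c s1 s2 s3 t1 t2 hb _ IH1 _ IH2 s' t' E.
  inversion E as [| | | | | |? ? ? ? ? ? ? _ E1 E2|? ? ? nb]; subst.
    by have [? ?] := IH1 _ _ E1; subst; have [-> ->] := IH2 _ _ E2.
  by rewrite hb in nb.
- move=> b c s nb s' t' E.
  inversion E as [| | | | | |? ? ? ? ? ? ? hb _ _|? ? ? _]; subst => //.
  by rewrite hb in nb.
Qed.

(* Output convention: the centers in natural array 0, the radius in cell 0 of
   real array 0. *)
Definition out_centers (s : state R) : {set points P} := array_set (nmem s 0).

Definition out_radius (s : state R) : R := rmem s 0 0.

End Semantics.

(* Main.v *)
(* For a fixed radius r, call a set S of points Rado independent if its points u
   have distinct representatives f u within distance 2r whose set is independent
   in M.  The greedy algorithm repeatedly takes an untried point s whose ball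
   B(s, r) has the largest uncovered weight, adds it to S if S + s is Rado
   independent, and then declares B(s, 3r) covered.  The representatives of the
   final S cover all of this within radius 5r.

   If B(C*, r) has weight at least m for an independent set C*, then throughout
   the run some C, with S represented and C representing itself by disjoint sets
   with independent union, is such that the covered set together with B(C, r)
   weighs at least m.  When s is added: if B(s, r) meets B(c, r) for some c in C,
   then c can represent s and B(c, r) lies in B(s, 3r), so c is dropped.
   Otherwise a matroid exchange drops some c from C, and the uncovered part of
   B(c, r) weighs at most that of B(s, r), which no ball of C meets.

   Rado independence of S + s is decided by a search from s: u leads to v if the
   representative of v may be replaced by some x within 2r of u.  If the search
   does not return to s, the set it reached violates Rado's condition;
   otherwise the representatives are shifted along the path back to s.

   The optimal radius is one of the distances, so the algorithm tries them all. *)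

Require Import Defs.
From HB Require Import structures.
From mathcomp Require Import all_boot all_order all_algebra reals.
From mathcomp Require Import zify ring.

Set Implicit Arguments.
Unset Strict Implicit.
Unset Printing Implicit Defensive.

Import Order.TTheory GRing.Theory Num.Theory.
Local Open Scope ring_scope.

(** * Matroids and independent systems of representatives *)

Section Matroid.
Variables (X : finType) (I : {set {set X}}).
Hypothesis matI : is_matroid I.
Implicit Types (A B D J : {set X}) (x y z u v : X).

(** For independent [A], the negation says that [x] lies in the span of [A]; spans are used only in
    this form. *)
Definition can_add A x := (x \notin A) && (x |: A \in I).

Lemma indepS A B : A \subset B -> B \in I -> A \in I.
Proof. by case: matI => _ + _; apply. Qed.

(** Iterated augmentation, by induction on the deficit [#|B| - #|A|]. *)
Lemma indep_extend A B : A \in I -> B \in I -> (#|A| <= #|B|)%N ->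
  exists K : {set X}, [/\ A \subset K, K \subset A :|: B, K \in I & #|K| = #|B|].
Proof.
move=> + BI; move En: (#|B| - #|A|)%N => n.
elim: n A En => [|n IH] A En AI leAB.
  by exists A; split; rewrite ?subsetUl //; lia.
have [] : exists2 x, x \in B :\: A & x |: A \in I.
  by case: matI => _ _; apply => //; lia.
move=> x; rewrite inE => /andP[xA xB] xAI.
have cxA : #|x |: A| = #|A|.+1 by rewrite cardsU1 xA.
have [] := IH (x |: A); rewrite ?cxA //; try lia.
move=> K [sK Ks KI cK]; exists K; split=> //.
  exact: subset_trans (subsetUr _ _) sK.
apply: subset_trans Ks _; rewrite -setUA subUset subxx andbT.
by rewrite sub1set inE xB orbT.
Qed.

Lemma can_addS A B x : A \subset B -> can_add B x -> can_add A x.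
Proof.
move=> sAB /andP[xB xBI]; apply/andP; split.
  by apply: contra xB; apply/subsetP.
by apply: indepS xBI; rewrite setUS.
Qed.

Lemma card_span D J : D \in I -> J \in I ->
  (forall x, x \in J -> ~~ can_add D x) -> (#|J| <= #|D|)%N.
Proof.
move=> DI JI spanJ; rewrite leqNgt; apply/negP => ltDJ.
case: matI => _ _ /(_ D J DI JI ltDJ) [x]; rewrite inE => /andP[xD xJ] xDI.
by have := spanJ x xJ; rewrite /can_add xD xDI.
Qed.

(* Spans of subsets of an independent set intersect in the span of the
   intersection; here for the subsets [A] and [A :\ y], [y \in A :\: D]. *)
Lemma span_localize A D x : A \in I -> D \subset A -> ~~ can_add A x ->
  (forall y, y \in A :\: D -> ~~ can_add (A :\ y) x) -> ~~ can_add D x.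
Proof.
move=> AI sDA nAx nyx; apply/negP => /andP[xD xDI].
have [xA|xA] := boolP (x \in A).
  have := nyx x; rewrite !inE xD xA => /(_ isT).
  by rewrite /can_add !inE eqxx /= setD1K // AI.
have [ltDA|leAD] := ltnP #|D| #|A|; last first.
  have AD : D = A by apply/eqP; rewrite eqEcard sDA.
  by move: nAx; rewrite /can_add xA -AD xDI.
(* [K] has the size of [A] and contains [x], which is outside [A], so it misses some [y] of [A]; by
   counting it equals [x |: (A :\ y)], which the hypothesis on [y] forbids. *)
have [|K [sK Ks KI cK]] := indep_extend xDI AI; first by rewrite cardsU1 xD.
have [y yA yK] : exists2 y, y \in A & y \notin K.
  apply/subsetPn/negP => sAK.
  have : (#|x |: A| <= #|K|)%N.
    apply: subset_leq_card; rewrite subUset sAK andbT sub1set.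
    by rewrite (subsetP sK) // setU11.
  by rewrite cardsU1 xA cK ltnn.
have yD : y \notin D by apply: contra yK => yD; rewrite (subsetP sK) // setU1r.
have xAy : x \notin A :\ y by rewrite inE (negbTE xA) andbF.
have := nyx y; rewrite inE yD yA /can_add xAy => /(_ isT)/negP; apply.
suff <- : K = x |: (A :\ y) by [].
apply/eqP; rewrite eqEcard cK cardsU1 xAy (cardsD1 y A) yA leqnn andbT.
apply/subsetP => z zK; have := subsetP Ks z zK; rewrite !inE.
case: eqVneq => [//|_] /=; case: (eqVneq z y) => [zy|_] /=.
  by rewrite -zy zK in yK.
by case/orP => [/(subsetP sDA)|].
Qed.

(* [C + x] is independent and [z] lies in the span of [D], so replacing [y] by
   [z] inside [D] does not change that span. *)
Lemma can_add_exchange C D x y z : x |: C \in I -> x \notin C ->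
  D \subset C -> y \in D -> can_add (D :\ y) z -> ~~ can_add D z ->
  can_add (x |: (C :\ y)) z.
Proof.
move=> xCI xC sDC yD /andP[zDy zDyI] nDz.
(* The extension has the size of [x |: C]. It cannot contain a [y] other than [z], since [z |: D]
   would then be independent; so it fills all of [z |: (x |: (C :\ y))]. *)
have [|K [sK Ks KI cK]] := indep_extend zDyI xCI.
  rewrite !cardsU1 zDy xC ltnS; apply: subset_leq_card.
  exact: subset_trans (subD1set _ _) sDC.
have {}Ks : K \subset z |: (x |: (C :\ y)).
  apply/subsetP => u uK; have := subsetP Ks u uK; rewrite !inE.
  have zK : z \in K by rewrite (subsetP sK) ?setU11.
  case: (eqVneq u z) => //= uz; case: (eqVneq u x) => //= ux.
  case: (eqVneq u y) => [uy|_] /=; last by case/orP => [/(subsetP sDC)|].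
  have zD : z \notin D by move: zDy; rewrite !inE -uy eq_sym uz.
  case/negP: nDz; rewrite /can_add zD; apply: indepS KI.
  apply/subsetP => w; rewrite !inE => /orP[/eqP->//|wD].
  have [->|wy] := eqVneq w y; first by rewrite -uy.
  by rewrite (subsetP sK) // !inE wy wD orbT.
have yC : y \in C by apply: (subsetP sDC).
have xCy : x \notin C :\ y by rewrite inE (negbTE xC) andbF.
have cC : #|x |: (C :\ y)| = #|C| by rewrite cardsU1 xCy (cardsD1 y C) yC.
have cxC : #|x |: C| = #|C|.+1 by rewrite cardsU1 xC.
move: (x |: (C :\ y)) cC Ks => E cE Ks.
have zE : z \notin E.
  apply/negP => zE; have := subset_leq_card Ks.
  by rewrite cK cxC cardsU1 zE cE ltnn.
rewrite /can_add zE; suff <- : K = z |: E by [].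
by apply/eqP; rewrite eqEcard Ks cardsU1 zE cK cxC cE /=.
Qed.

End Matroid.

(** * Rado independence: exchanging representatives *)

Section Rado.
Variables (X : finType) (I : {set {set X}}) (N : rel X).
Hypothesis matI : is_matroid I.
Implicit Types (A C D J S T : {set X}) (x y z u v : X) (f g : X -> option X).

Definition dom f : {set X} := [set u | isSome (f u)].

Definition rimg f T : {set X} := [set y | [exists u in T, f u == Some y]].

(* A partial system of distinct representatives of the sets [N u]. *)
Definition is_sdr f : Prop :=
  [/\ forall u x, f u = Some x -> N u x,
      forall u v x, f u = Some x -> f v = Some x -> u = v &
      rimg f setT \in I].

Definition rado S : Prop := exists2 f, is_sdr f & dom f = S.

Definition assign f u x : X -> option X :=
  fun v => if v == u then Some x else f v.

(** Here [u] gives up its own representative, if it has one, before [x] is tried; for [u] outside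
    [dom f] this is extension of the whole image. *)
Definition addable f u x := can_add I (rimg f (~: [set u])) x.

Lemma rimgP f T y :
  reflect (exists2 u, u \in T & f u = Some y) (y \in rimg f T).
Proof.
rewrite inE; apply: (iffP existsP) => [[u /andP[? /eqP ?]]|[u uT fu]].
  by exists u.
by exists u; rewrite uT fu eqxx.
Qed.

Lemma rimgS f S T : S \subset T -> rimg f S \subset rimg f T.
Proof.
move=> /subsetP sST; apply/subsetP => y /rimgP[u uS fu].
by apply/rimgP; exists u => //; apply: sST.
Qed.

Lemma card_rimg f T : is_sdr f -> #|rimg f T| = #|T :&: dom f|.
Proof.
case=> _ injf _.
rewrite -(card_imset _ (@Some_inj _)) -(@card_in_imset _ _ f (T :&: dom f)).
  congr #|pred_of_set _|; apply/setP => o; apply/imsetP/imsetP.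
    case=> y /rimgP[u uT fu] ->; exists u => //.
    by rewrite !inE uT fu.
  case=> u; rewrite !inE; case Ef: (f u) => [y|] /andP[uT] // _ ->.
  by exists y => //; apply/rimgP; exists u.
move=> u v; rewrite !inE => /andP[_]; case Ef: (f u) => [y|] // _ _ fv.
by apply: injf Ef _.
Qed.

Lemma dom_assign f u x : dom (assign f u x) = u |: dom f.
Proof. by apply/setP => v; rewrite !inE /assign; case: eqP. Qed.

Lemma rimg_assign f u x :
  rimg (assign f u x) setT = x |: rimg f (~: [set u]).
Proof.
apply/setP => y; apply/rimgP/setU1P => [[v _]|[->|/rimgP[v]]].
- rewrite /assign; case: eqVneq => [_ [->]|vu fv]; [by left|right].
  by apply/rimgP; exists v; rewrite // !inE.
- by exists u; rewrite // /assign eqxx.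
- by rewrite !inE => vu fv; exists v; rewrite // /assign (negbTE vu).
Qed.

Lemma rimg_notin f u : u \notin dom f -> rimg f (~: [set u]) = rimg f setT.
Proof.
move=> uf; apply/setP => y; apply/rimgP/rimgP => -[v vT fv]; exists v => //.
by rewrite !inE; apply: contra uf => /eqP <-; rewrite inE fv.
Qed.

Lemma rimgD1 f u x : is_sdr f -> f u = Some x ->
  rimg f (~: [set u]) = rimg f setT :\ x.
Proof.
case=> _ injf _ fu; apply/setP => y; rewrite [RHS]inE.
apply/rimgP/andP => [[v vu fv]|[yx /rimgP[v _ fv]]].
  split; last by apply/rimgP; exists v.
  apply: contraL vu; rewrite inE => /eqP yx.
  by rewrite !inE negbK (injf v u x) // -yx.
exists v => //; rewrite !inE; apply: contra yx => /eqP vu.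
by move: fv; rewrite vu fu => -[->]; rewrite inE.
Qed.

Lemma sdr_assign f u x : is_sdr f -> N u x -> addable f u x ->
  is_sdr (assign f u x).
Proof.
case=> Nf injf fI Nux /andP[xf xfI]; split.
- by move=> v y; rewrite /assign; case: eqP => [-> [<-]|_ /Nf].
- move=> v w y; rewrite /assign.
  have notx z : z != u -> f z <> Some x.
    by move=> zu fz; case/rimgP: xf; exists z; rewrite // !inE.
  case: (eqVneq v u) => [->|vu]; case: (eqVneq w u) => [->|wu] //.
  + by move=> [<-] /notx-/(_ wu).
  + by move=> fv [xy]; rewrite -xy in fv; case: (notx v vu).
  + exact: injf.
- by rewrite rimg_assign.
Qed.

Lemma addable_sub f u x : can_add I (rimg f setT) x -> addable f u x.
Proof. by apply: can_addS => //; apply: rimgS. Qed.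

Lemma sdr_restrict f S : is_sdr f -> S \subset dom f -> rado S.
Proof.
case=> Nf injf fI sSf; exists (fun u => if u \in S then f u else None).
  split=> [u x|u v x|]; first by case: ifP => // _ /Nf.
    by case: ifP => // _ fu; case: ifP => // _; apply: injf.
  apply: (indepS matI) fI; apply/subsetP => y /rimgP[u _].
  by case: ifP => // _ fu; apply/rimgP; exists u.
apply/setP => u; rewrite inE; case: ifP => // uS.
by have := subsetP sSf u uS; rewrite inE.
Qed.

Lemma radoS S T : S \subset T -> rado T -> rado S.
Proof. by move=> sST [f sf df]; rewrite -df in sST; apply: sdr_restrict sST. Qed.

(* [T] is the set of vertices reached by an unsuccessful search from [s]. *)
Lemma closed_not_rado f s T : is_sdr f -> s \notin dom f -> s \notin T ->
  (forall u x v, u \in s |: T -> N u x -> addable f v x -> v \in T) ->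
  ~ rado (s |: dom f).
Proof.
move=> sf sd sT closed [g sg dg].
pose T0 := T :&: dom f; pose D := rimg f T0.
have [[_ _ fI] [Ng injg gI]] := (sf, sg).
have cD : #|D| = #|T0| by rewrite card_rimg // setIAC -setIA setIid.
(* If [g] represented [s |: dom f], the [#|T0| + 1] representatives of [s |: T0] would all be
   spanned by the [#|T0|] elements of [D]. *)
have : (#|rimg g (s |: T0)| <= #|D|)%N.
  apply: (card_span matI) => //.
  - by apply: (indepS matI) fI; apply: rimgS.
  - by apply: (indepS matI) gI; apply: rimgS.
  move=> x /rimgP[u uT gu].
  have uT' : u \in s |: T.
    by move: uT; rewrite !inE => /orP[->|/andP[-> _]]; rewrite ?orbT.
  (* The whole image spans [x], since closure would otherwise put [s] into [T]. Dropping the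
     representative of a [v] outside [T] keeps [x] spanned, since closure would otherwise put [v]
     into [T]. *)
  apply: (@span_localize _ I matI (rimg f setT)) => //; first exact: rimgS.
    rewrite -(rimg_notin sd); apply: contra sT => fs.
    by apply: closed uT' (Ng _ _ gu) fs.
  move=> y; rewrite inE => /andP[yD /rimgP[v _ fv]].
  rewrite -(rimgD1 sf fv); apply: contra yD => fvx.
  apply/rimgP; exists v => //; rewrite !inE fv andbT.
  by apply: closed uT' (Ng _ _ gu) fvx.
rewrite cD card_rimg // dg (setIidPl _) ?cardsU1.
  by rewrite inE (negbTE sT) /= ltnn.
by rewrite setUS // subsetIr.
Qed.

(* A search from [s] has numbered the vertices it reached; [u] could give way to
   [z] in [f].  In [g], which differs from [f] only at vertices numbered later,
   the representative of [u] is about to become [x]. *)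
Lemma search_exchange f g (m : X -> nat) s u x z :
  is_sdr f -> is_sdr g -> s \notin dom f -> (m u < m s)%N -> addable f u z ->
  (forall v, addable f v z -> (0 < m v <= m u)%N) ->
  (forall v, (0 < m v <= m u)%N -> g v = f v) ->
  can_add I (rimg g setT) x ->
  u \in dom f /\ can_add I (rimg (assign g u x) setT) z.
Proof.
move=> sf sg sd lt_us fuz first_z gf gx.
(* Only vertices numbered up to [m u] can give way to [z], which excludes [s]; as [s] has no
   representative, the whole image of [f] spans [z]. *)
have nsz : ~~ addable f s z.
  by apply/negP => /first_z/andP[_]; rewrite leqNgt lt_us.
have ud : u \in dom f.
  apply: contraR nsz => ud.
  by move: fuz; rewrite /addable !rimg_notin.
split=> //; have mu := first_z _ fuz.
move: (ud); rewrite inE; case fu: (f u) => [y|] // _.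
have gu : g u = Some y by rewrite gf.
(* On the vertices numbered at most [m u] the two systems agree, so their representatives there form
   a common subset, inside which [y] is exchanged for [z]. *)
pose T := [set v | (0 < m v <= m u)%N].
have gT : rimg g T = rimg f T.
  by apply/setP => w; apply/rimgP/rimgP => -[v vT <-]; exists v; rewrite // gf //;
     move: vT; rewrite inE.
have yT : y \in rimg f T by apply/rimgP; exists u; rewrite // inE.
have [/andP[xg xgI] [_ _ fI]] := (gx, sf).
rewrite rimg_assign (rimgD1 sg gu).
apply: (can_add_exchange matI xgI xg) (yT) _ _.
- by rewrite -gT; apply: rimgS.
- apply: (can_addS matI) fuz; rewrite (rimgD1 sf fu).
  by apply: setSD; apply: rimgS.
apply: (span_localize matI fI); first exact: rimgS.
  by rewrite -(rimg_notin sd).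
move=> w; rewrite inE => /andP[wT /rimgP[v _ fv]].
rewrite -(rimgD1 sf fv); apply: contra wT => /first_z mv.
by apply/rimgP; exists v; rewrite // inE.
Qed.

(* [S] uses its representatives while [C] represents itself. *)
Definition mixed S C : Prop :=
  exists f, [/\ is_sdr f, dom f = S, [disjoint rimg f setT & C]
              & rimg f setT :|: C \in I].

(** Being independent of the representatives of [S], the point [c] can represent itself. This makes
    every element of [C] outside [S] a competitor in the greedy choice. *)
Lemma mixed_rado S C c : mixed S C -> c \in C -> N c c -> rado (c |: S).
Proof.
case=> f [sf df disj fCI] cC Ncc.
have cf : c \notin rimg f setT.
  by apply: contraL cC => cf; rewrite (disjointFr disj cf).
exists (assign f c c); last by rewrite dom_assign df.
apply: sdr_assign => //; apply: addable_sub; rewrite /can_add cf.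
by apply: (indepS matI) fCI; rewrite subUset subsetUl sub1set inE cC orbT.
Qed.

(* Among the systems for [S + s], one agreeing with [g] as often as possible on
   [S] can be extended to the required size by elements of [C] only. *)
Lemma mixed_exchange S C s : s \notin S -> mixed S C -> rado (s |: S) ->
  exists C', [/\ C' \subset C, (#|C| <= #|C'|.+1)%N & mixed (s |: S) C'].
Proof.
have aux (a b : nat) : (0 < b -> b <= (a + b - a.+1).+1)%N by lia.
move=> sS [g [sg dg disj gCI]] [f].
move En: #|[set u in S | f u != g u]| => n.
elim/ltn_ind: n f En => n IH f En sf df.
have [->|/set0Pn[c cC]] := eqVneq C set0.
  exists set0; rewrite sub0set cards0; split=> //; exists f.
  rewrite setU0 -setI_eq0 setI0; split=> //; by case: sf.
have [[Nf injf fI] [Ng injg gI]] := (sf, sg).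
have cf : #|rimg f setT| = #|S|.+1 by rewrite card_rimg // df setTI cardsU1 sS.
have cgC : #|rimg g setT :|: C| = (#|S| + #|C|)%N.
  rewrite cardsU; move: disj; rewrite -setI_eq0 => /eqP ->.
  by rewrite cards0 subn0 card_rimg // dg setTI.
have C0 : (0 < #|C|)%N by apply/card_gt0P; exists c.
have [|L [sL Ls LI cL]] := indep_extend matI fI gCI; first by rewrite cf cgC; lia.
(* If the extension uses only elements of [C], it yields [C']. Otherwise it contains some [z = g u]
   that [f] does not use, and moving [u] to [z] in [f] lowers the number of disagreements with
   [g]. *)
have [sLC|] := boolP (L :\: rimg f setT \subset C).
  exists (L :\: rimg f setT); split=> //.
    by rewrite cardsD (setIidPr sL) cL cgC cf aux.
  exists f; split=> //; first by rewrite disjoint_sym disjoints_subset subsetDr.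
  by rewrite -[X in X :|: _](setIidPr sL) setID.
case/subsetPn => z; rewrite inE => /andP[zf zL] zC.
have := subsetP Ls z zL; rewrite !in_setU (negbTE zf) (negbTE zC) orbF /=.
case/rimgP => u _ gu.
have uS : u \in S by rewrite -dg inE gu.
have fz : addable f u z.
  apply: addable_sub; rewrite /can_add zf; apply: (indepS matI) LI.
  by rewrite subUset sL sub1set zL.
apply: (IH _ _ (assign f u z) erefl).
- rewrite -En; apply: proper_card; apply/properP; split.
    apply/subsetP => v; rewrite !inE /assign; case: (eqVneq v u) => [->|//].
    by rewrite gu eqxx andbF.
  exists u; rewrite !inE uS /= /assign ?eqxx ?gu ?eqxx //.
  by apply: contraNneq zf => fu; apply/rimgP; exists u; rewrite // fu.
- exact: sdr_assign (Ng _ _ gu) fz.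
- by rewrite dom_assign df; apply/setUidPr; rewrite sub1set setU1r.
Qed.

End Rado.

(** * One step of the greedy algorithm *)

Section GreedyStep.
Variables (R : realType) (P : rmc_instance R) (r : R).
Hypothesis r_ge0 : 0 <= r.
Implicit Types (S C U V : {set points P}) (s c u v : points P).

Let I := indep P.

Definition near (t : R) : rel (points P) := fun u x => dist u x <= t.

Lemma distxx u : dist u u = 0.
Proof. by case: (dist_metric P) => _ h _ _; apply/h. Qed.

Lemma dist_sym u v : dist u v = dist v u.
Proof. by case: (dist_metric P). Qed.

Lemma dist_triangle u v x : dist u x <= dist u v + dist v x.
Proof. by case: (dist_metric P). Qed.

Lemma set_weightS U V : U \subset V -> set_weight U <= set_weight V.
Proof.
move=> sUV; rewrite /set_weight [leRHS](big_setID U) /= (setIidPr sUV) lerDl.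
by apply: sumr_ge0 => u _; apply: weight_ge0.
Qed.

Lemma set_weightUD U V :
  set_weight (U :|: V) = set_weight U + set_weight (V :\: U).
Proof.
by rewrite /set_weight [LHS](big_setID U) /= setUK setDUl setDv set0U.
Qed.

Definition gain U u : R := set_weight (cball u r :\: U).

Lemma cballsP C t v :
  reflect (exists2 u, u \in C & dist u v <= t) (v \in cballs C t).
Proof.
apply: (iffP bigcupP) => -[u uC]; first by rewrite inE; exists u.
by move=> duv; exists u; rewrite ?inE.
Qed.

Lemma greedy_step S U C s :
  cballs S r \subset U -> s \notin S -> rado I (near (r + r)) (s |: S) ->
  mixed I (near (r + r)) S C ->
  (forall c, c \notin S -> rado I (near (r + r)) (c |: S) ->
    gain U c <= gain U s) ->
  exists2 C', mixed I (near (r + r)) (s |: S) C' &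
    set_weight (U :|: cballs C r) <=
    set_weight (U :|: cball s (r + r + r) :|: cballs C' r).
Proof.
move=> SU sS sR mSC max_s; have matI := indep_matroid P.
(* A point already in [S] has gain 0, its ball being covered; any other one is a competitor of [s]
   by [mixed_rado]. *)
have gainC c : c \in C -> gain U c <= gain U s.
  move=> cC; have [cS|cS] := boolP (c \in S); last first.
    apply: max_s => //; apply: (mixed_rado matI mSC) => //.
    by rewrite /near distxx addr_ge0.
  suff -> : gain U c = 0 by apply: sumr_ge0 => u _; apply: weight_ge0.
  rewrite /gain (_ : _ :\: _ = set0) /set_weight ?big_set0 //.
  apply/eqP; rewrite setD_eq0; apply: subset_trans SU.
  by apply: (bigcup_max c).
have [/exists_inP[c cC /existsP[v]]|far] := boolP
  [exists c in C, [exists v, (v \in cball c r) && (v \in cball s r)]].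
  rewrite !inE => /andP[dcv dsv].
  have dsc : dist s c <= r + r.
    by apply: le_trans (dist_triangle s v c) _; rewrite (dist_sym v c) lerD.
  exists (C :\ c).
    case: mSC => f [sf df disj fCI].
    have cf : c \notin rimg f setT.
      by apply: contraL cC => cf; rewrite (disjointFr disj cf).
    have sf' : s \notin dom f by rewrite df.
    exists (assign f s c); rewrite dom_assign rimg_assign rimg_notin // df.
    split=> //.
    - apply: sdr_assign => //; apply: (addable_sub matI).
      rewrite /can_add cf; apply: (indepS matI) fCI.
      by rewrite subUset subsetUl sub1set inE cC orbT.
    - rewrite -setI_eq0 setIUl setU_eq0 !setI_eq0 disjoints1 !inE eqxx /=.
      by apply: disjointWr disj; apply: subD1set.
    - by rewrite setUC setUA (setUC _ [set c]) setD1K // setUC.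
  apply: set_weightS; rewrite -setUA setUS //.
  apply/subsetP => x /cballsP[u uC dux]; rewrite inE.
  have [uc|uc] := eqVneq u c.
    rewrite inE (le_trans (dist_triangle s c x)) // lerD //.
    by rewrite -uc.
  by apply/orP; right; apply/cballsP; exists u; rewrite // !inE uc.
have [C' [sC' cC' mC']] := mixed_exchange matI sS mSC sR.
exists C' => //.
have disj : [disjoint cball s r & cballs C' r].
  rewrite disjoint_subset; apply/subsetP => v vs; rewrite inE.
  apply/cballsP => -[c cC dcv]; case/negP: far.
  apply/exists_inP; exists c; first exact: (subsetP sC').
  by apply/existsP; exists v; rewrite vs inE dcv.
have sr3 : cball s r \subset cball s (r + r + r).
  apply/subsetP => v; rewrite !inE => /le_trans; apply.
  by rewrite lerDr addr_ge0.
have [CC'|/subsetPn[c cC ccC']] := boolP (C \subset C').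
  apply: set_weightS; rewrite setUSS ?subsetUl //.
  apply/subsetP => x /cballsP[u uC dux]; apply/cballsP.
  by exists u; rewrite ?(subsetP CC').
have sCc : C \subset c |: C'.
  suff /eqP-> : C == c |: C' by [].
  rewrite eq_sym eqEcard subUset sub1set cC sC' cardsU1 ccC' /=.
  by rewrite add1n.
(* The ball of [c] is traded for that of [s]: the former contributes at most [gain U c], the latter
   all of [gain U s], because it misses the balls of [C']. *)
apply: (@le_trans _ _ (set_weight ((U :|: cballs C' r) :|: cball c r))).
  apply: set_weightS; rewrite -setUA setUS //.
  apply/subsetP => x /cballsP[u /(subsetP sCc)]; rewrite !inE.
  case/orP => [/eqP->->|uC' dux]; first by rewrite orbT.
  by apply/orP; left; apply/cballsP; exists u.
apply: (@le_trans _ _ (set_weight ((U :|: cballs C' r) :|: cball s r))).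
  rewrite !set_weightUD lerD2l.
  apply: (@le_trans _ _ (gain U c)).
    by apply: set_weightS; rewrite setDS ?subsetUl.
  apply: le_trans (gainC c cC) _; apply: set_weightS.
  by rewrite setDUr subsetI subxx subsetD subsetDl (disjointWl _ disj) ?subsetDl.
by apply: set_weightS; rewrite setUAC setUSS // setUS.
Qed.

End GreedyStep.

(** * Programs with counted loops *)

(* [PFor a p] runs [p] with cell 0 of array [a] going through the numbers of all
   points; without other loops, every program halts in polynomial time. *)
Inductive prog : Type :=
  | PSkip
  | PNSet of nat & nexp & nexp
  | PRSet of nat & nexp & rexp
  | PSeq of prog & prog
  | PIf of bexp & prog & prog
  | PFor of nat & prog.

Definition nvar (a : nat) : nexp := NGet a (NConst 0).

Definition incr (a : nat) : cmd :=
  NSet a (NConst 0) (NAdd (nvar a) (NConst 1)).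

Fixpoint compile (p : prog) : cmd :=
  match p with
  | PSkip => Skip
  | PNSet a e1 e2 => NSet a e1 e2
  | PRSet a e1 e2 => RSet a e1 e2
  | PSeq p q => Seq (compile p) (compile q)
  | PIf b p q => If b (compile p) (compile q)
  | PFor a p =>
      Seq (NSet a (NConst 0) (NConst 0))
        (While (BNot (BLeN NSize (nvar a))) (Seq (compile p) (incr a)))
  end.

Fixpoint nmods (p : prog) : seq nat :=
  match p with
  | PSkip | PRSet _ _ _ => [::]
  | PNSet a _ _ => [:: a]
  | PSeq p q | PIf _ p q => nmods p ++ nmods q
  | PFor a p => a :: nmods p
  end.

Fixpoint rmods (p : prog) : seq nat :=
  match p with
  | PSkip | PNSet _ _ _ => [::]
  | PRSet a _ _ => [:: a]
  | PSeq p q | PIf _ p q => rmods p ++ rmods q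
  | PFor _ p => rmods p
  end.

(** A loop body must not write to the array of its own counter; this makes [PFor] run exactly once
    per point. *)
Fixpoint wf (p : prog) : bool :=
  match p with
  | PSkip | PNSet _ _ _ | PRSet _ _ _ => true
  | PSeq p q | PIf _ p q => wf p && wf q
  | PFor a p => (a \notin nmods p) && wf p
  end.

(** * Denotational semantics, frame properties and the loop rule *)

Section Denotation.
Variables (R : realType) (P : rmc_instance R).
Implicit Types (s : state R) (p q : prog) (x : points P).

Definition setn s a i v : state R := State (update (nmem s) a i v) (rmem s).

Definition setr s a i v : state R := State (nmem s) (update (rmem s) a i v).

Fixpoint den p s : state R :=
  match p with
  | PSkip => s
  | PNSet a e1 e2 => setn s a (neval P s e1) (neval P s e2)
  | PRSet a e1 e2 => setr s a (neval P s e1) (reval P s e2)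
  | PSeq p q => den q (den p s)
  | PIf b p q => if beval P s b then den p s else den q s
  | PFor a p =>
      iter #|points P|
        (fun s => let s' := den p s in setn s' a 0 (nmem s' a 0 + 1))
        (setn s a 0 0)
  end.

Lemma nmem_setn s a i v b :
  b != a -> nmem (setn s a i v) b = nmem s b.
Proof. by rewrite /setn /update /=; case: (b == a). Qed.

Lemma rmem_setr s a i v b :
  b != a -> rmem (setr s a i v) b = rmem s b.
Proof. by rewrite /setr /update /=; case: (b == a). Qed.

Lemma nmem_den p s a : a \notin nmods p -> nmem (den p s) a = nmem s a.
Proof.
elim: p s => //= [b e1 e2|p IHp q IHq|e p IHp q IHq|b p IHp] s.
- by rewrite inE => ab; apply: (nmem_setn s).
- by rewrite mem_cat negb_or => /andP[ap aq]; rewrite IHq ?IHp.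
- by rewrite mem_cat negb_or => /andP[ap aq]; case: ifP; rewrite ?IHq ?IHp.
rewrite inE negb_or => /andP[ab ap].
elim: #|_| => [|n IH]; first exact: (nmem_setn s).
by rewrite iterS (nmem_setn (den p _)) // IHp.
Qed.

Lemma rmem_den p s a : a \notin rmods p -> rmem (den p s) a = rmem s a.
Proof.
elim: p s => //= [b e1 e2|p IHp q IHq|e p IHp q IHq|b p IHp] s.
- by rewrite inE => ab; apply: (rmem_setr s).
- by rewrite mem_cat negb_or => /andP[ap aq]; rewrite IHq ?IHp.
- by rewrite mem_cat negb_or => /andP[ap aq]; case: ifP; rewrite ?IHq ?IHp.
by move=> ap; elim: #|_| => [|n IH] //; rewrite iterS /= IHp.
Qed.

Definition nr x : nat := enum_rank x.

Lemma nr_inj : injective nr.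
Proof. by move=> x y /ord_inj/enum_rank_inj. Qed.

Lemma eq_nr x y : (nr x == nr y) = (x == y).
Proof. exact: (inj_eq nr_inj). Qed.

Lemma point_nrK x : point_nr P (nr x) = Some x.
Proof.
rewrite /point_nr /nr; have := ltn_ord (enum_rank x).
rewrite {2}cardT => lt_x.
rewrite onthE (nth_map x) //; congr Some.
by rewrite -[RHS](enum_rankK x) (enum_val_nth x).
Qed.

Lemma dist_nrE x y : dist_nr P (nr x) (nr y) = dist x y.
Proof. by rewrite /dist_nr !point_nrK. Qed.

Lemma weight_nrE x : weight_nr P (nr x) = weight x.
Proof. by rewrite /weight_nr point_nrK. Qed.

(** The invariant is indexed by the set of points already visited, so that proofs need not mention
    the order of enumeration. Its step also receives the frame facts: arrays the loop does not write
    keep their contents from before it. *)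
Lemma den_for (Inv : {set points P} -> state R -> Prop) (a : nat) p s :
  a \notin nmods p ->
  Inv set0 (setn s a 0 0) ->
  (forall (A : {set points P}) x t, x \notin A -> nmem t a 0 = nr x ->
    (forall b : nat, b \notin a :: nmods p -> nmem t b = nmem s b) ->
    (forall b : nat, b \notin rmods p -> rmem t b = rmem s b) ->
    Inv A t -> Inv (x |: A) (setn (den p t) a 0 (nr x).+1)) ->
  Inv setT (den (PFor a p) s).
Proof.
move=> ap Inv0 InvS; pose low k := [set x | (nr x < k)%N].
have <- : low #|points P| = setT by apply/setP => x; rewrite !inE ltn_ord.
pose loop k := iter k
  (fun s => let s' := den p s in setn s' a 0 (nmem s' a 0 + 1)) (setn s a 0 0).
rewrite -[den _ _]/(loop #|points P|).
suff: forall k, (k <= #|points P|)%N ->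
    [/\ nmem (loop k) a 0 = k, Inv (low k) (loop k),
        forall b : nat, b \notin a :: nmods p -> nmem (loop k) b = nmem s b &
        forall b : nat, b \notin rmods p -> rmem (loop k) b = rmem s b].
  by move/(_ _ (leqnn _))=> [].
elim=> [_|k IH lt_k].
  split=> //; first by rewrite /= /update !eqxx.
  by move=> b; rewrite inE negb_or => /andP[ba _]; apply: (nmem_setn s).
have [Ek Ik fr frr] := IH (ltnW lt_k).
have -> : loop k.+1 = setn (den p (loop k)) a 0 k.+1.
  by rewrite {1}/loop iterS -/(loop k) /= nmem_den // Ek addn1.
split.
- by rewrite /= /update !eqxx.
- pose x := enum_val (Ordinal lt_k).
  have Ex : nr x = k by rewrite /nr enum_valK.
  rewrite -[in low _]Ex (_ : low _ = x |: low (nr x)); last first.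
    by apply/setP => y; rewrite !inE ltnS leq_eqVlt eq_nr.
  by rewrite -Ex; apply: InvS; rewrite ?inE ?ltnn ?Ex.
- move=> b /[dup] /fr <-; rewrite inE negb_or => /andP[ba bp].
  by rewrite nmem_setn // nmem_den.
- by move=> b bp; rewrite /= rmem_den // frr.
Qed.

End Denotation.

(** Induction on the syntax: sequencing and branching add the constants and take the larger
    exponent, and each loop raises the exponent by one. *)
Lemma prog_poly p : wf p -> exists c k : nat,
  forall (R : realType) (P : rmc_instance R) (s : state R),
  exists2 t, exec P (compile p) s (den P p s) t & (t <= c * #|points P|.+1 ^ k)%N.
Proof.
have le_exp n k l : (k <= l)%N -> (n.+1 ^ k <= n.+1 ^ l)%N by apply: leq_pexp2l.
have exp0 n k : (0 < n.+1 ^ k)%N by rewrite expn_gt0.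
elim: p => /= [_|a e1 e2 _|a e1 e2 _|p IHp q IHq|b p IHp q IHq|a p IHp].
- exists 1%N, 0%N => R P s; exists 1%N => //; exact: ExecSkip.
- exists (ncost e1 + ncost e2).+1, 0%N => R P s.
  by eexists; [apply: ExecNSet | rewrite expn0 muln1].
- exists (ncost e1 + rcost e2).+1, 0%N => R P s.
  by eexists; [apply: ExecRSet | rewrite expn0 muln1].
- case/andP => /IHp[c1 [k1 H1]] /IHq[c2 [k2 H2]].
  exists (c1 + c2).+1, (maxn k1 k2) => R P s.
  have [t1 E1 L1] := H1 R P s; have [t2 E2 L2] := H2 R P (den P p s).
  exists (t1 + t2).+1; first exact: ExecSeq E1 E2.
  rewrite mulSn mulnDl -addn1 addnC leq_add // leq_add //.
    by apply: leq_trans L1 _; rewrite leq_mul // le_exp // leq_maxl.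
  by apply: leq_trans L2 _; rewrite leq_mul // le_exp // leq_maxr.
- case/andP => /IHp[c1 [k1 H1]] /IHq[c2 [k2 H2]].
  exists (bcost b + c1 + c2).+1, (maxn k1 k2) => R P s.
  have [t1 E1 L1] := H1 R P s; have [t2 E2 L2] := H2 R P s.
  have M1 : (t1 <= c1 * #|points P|.+1 ^ maxn k1 k2)%N.
    by apply: leq_trans L1 _; rewrite leq_mul // le_exp // leq_maxl.
  have M2 : (t2 <= c2 * #|points P|.+1 ^ maxn k1 k2)%N.
    by apply: leq_trans L2 _; rewrite leq_mul // le_exp // leq_maxr.
  have M3 : (bcost b <= bcost b * #|points P|.+1 ^ maxn k1 k2)%N.
    by rewrite leq_pmulr.
  have := exp0 #|points P| (maxn k1 k2).
  move: (_ ^ _)%N M1 M2 M3 => E M1 M2 M3 M4.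
  case: (boolP (beval P s b)) => hb.
    exists (bcost b + t1).+1; first exact: ExecIfTrue.
    by rewrite mulSn !mulnDl; clear -M1 M2 M3 M4; lia.
  exists (bcost b + t2).+1; first exact: ExecIfFalse.
  by rewrite mulSn !mulnDl; clear -M1 M2 M3 M4; lia.
(* Beyond its body a pass costs 13: guard 5, increment 6, and one each for [Seq] and [While]. The
   last, failing guard costs 6 and the initialisation 4, so 24 covers the overhead. *)
case/andP => ap /IHp[c [k H]]; exists (c + 24)%N, k.+1 => R P s.
pose body s' := setn (den P p s') a 0 (nmem (den P p s') a 0 + 1).
pose n := #|points P|.
have loop m s' : (m <= n)%N -> nmem s' a 0 = (n - m)%N ->
  exists2 t, exec P (While (BNot (BLeN NSize (nvar a))) (Seq (compile p) (incr a)))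
               s' (iter m body s') t &
             (t <= 6 + m * (13 + c * n.+1 ^ k))%N.
  elim: m s' => [|m IH] s' le_m Es'.
    exists 6%N; last by rewrite leq_addr.
    by apply: (@ExecWhileFalse _ P); rewrite /= Es' subn0 negbK leqnn.
  have [t1 E1 L1] := H R P s'.
  have Eb : nmem (body s') a 0 = (n - m)%N.
    by rewrite /body /= /update !eqxx /= nmem_den // Es'; lia.
  have [t2 E2 L2] := IH _ (ltnW le_m) Eb.
  exists (5 + (t1 + 6).+1 + t2).+1; last by rewrite mulSn; move: L1 L2; rewrite -/n; lia.
  rewrite iterSr; apply: (@ExecWhileTrue _ P _ _ _ (body s')) E2.
    by rewrite /= Es' -/n -ltnNge; lia.
  by apply: ExecSeq E1 _; apply: (@ExecNSet _ P).
have [|t Et Lt] := loop n (setn s a 0 0) (leqnn _).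
  by rewrite /= /update !eqxx subnn.
exists (3 + t).+1.
  by apply: ExecSeq Et; apply: (@ExecNSet _ P).
rewrite -/n expnS.
have := exp0 n k; move: Lt; nia.
Qed.

Arguments den : simpl never.

(** * The algorithm *)

Local Notation "p ;; q" := (PSeq p q) (at level 60, right associativity).

Definition PWhen (b : bexp) (p : prog) : prog := PIf b p PSkip.

Definition beq (e1 e2 : nexp) : bexp := BAnd (BLeN e1 e2) (BLeN e2 e1).

Definition bpos (e : nexp) : bexp := BLeN (NConst 1) e.

Definition bor (b1 b2 : bexp) : bexp := BNot (BAnd (BNot b1) (BNot b2)).

Definition nscalar (a : nat) (e : nexp) : prog := PNSet a (NConst 0) e.

Definition rvar (a : nat) : rexp := RGet a (NConst 0).

Definition rscalar (a : nat) (e : rexp) : prog := PRSet a (NConst 0) e.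

(* [OUT] to [DONE] number arrays of naturals, [OUTR] to [TOTAL] arrays of reals. *)
Local Notation OUT := 0%N.
Local Notation REP := 1%N.
Local Notation MARK := 2%N.
Local Notation PARU := 3%N.
Local Notation PARX := 4%N.
Local Notation TMP := 5%N.
Local Notation COV := 6%N.
Local Notation TRIED := 7%N.
Local Notation FL := 8%N.
Local Notation CNT := 9%N.
Local Notation HAS := 10%N.
Local Notation SV := 11%N.
Local Notation LV := 12%N.
Local Notation UV := 13%N.
Local Notation XV := 14%N.
Local Notation VV := 15%N.
Local Notation ZV := 16%N.
Local Notation FOUND := 17%N.
Local Notation IV := 18%N.
Local Notation JV := 19%N.
Local Notation RV := 20%N.
Local Notation CU := 21%N.
Local Notation CX := 22%N.
Local Notation DONE := 23%N.

Local Notation OUTR := 0%N.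
Local Notation RR := 1%N.
Local Notation GAIN := 2%N.
Local Notation BEST := 3%N.
Local Notation TOTAL := 4%N.

Definition clear (a : nat) : prog := PFor ZV (PNSet a (nvar ZV) (NConst 0)).

(* Cell [u] of [REP] holds 1 + the number of the representative of [u], or 0. *)
Definition collect (a : nat) (b : bexp) : prog :=
  clear a ;;
  PFor ZV (PWhen (BAnd (bpos (NGet REP (nvar ZV))) b)
    (PNSet a (NSub (NGet REP (nvar ZV)) (NConst 1)) (NConst 1))).

(** The answer is left in [FL]. As in [can_add], the oracle is asked only if the new point is not
    already the representative of another point. *)
Definition test : prog :=
  collect TMP (BNot (beq (nvar ZV) (nvar VV))) ;;
  nscalar FL (NConst 0) ;;
  PWhen (BNot (bpos (NGet TMP (nvar XV))))
    (PNSet TMP (nvar XV) (NConst 1) ;;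
     PWhen (BIndep TMP) (nscalar FL (NConst 1))).

Definition label : prog :=
  PFor VV (PWhen (BNot (bpos (NGet MARK (nvar VV))))
    (test ;;
     PWhen (bpos (nvar FL))
       (PNSet MARK (nvar VV) (nvar CNT) ;;
        PNSet PARU (nvar VV) (nvar UV) ;;
        PNSet PARX (nvar VV) (nvar XV)))).

(** [CNT] counts scans, so all vertices reached by the same scan share a mark. The root [SV] is
    expanded without a mark; it gets one only when the search returns to it. *)
Definition scan : prog :=
  nscalar CNT (NAdd (nvar CNT) (NConst 1)) ;;
  PWhen (BAnd (bor (beq (nvar UV) (nvar SV)) (bpos (NGet MARK (nvar UV))))
           (BLeR (RDist (nvar UV) (nvar XV)) (RAdd (rvar RR) (rvar RR))))
    label.

Definition search : prog :=
  clear MARK ;;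
  nscalar CNT (NConst 0) ;;
  PFor LV (PFor UV (PFor XV scan)).

(** [CU] is the point about to receive the representative [CX]. The length of the path is not known
    beforehand, so [DONE] makes the remaining passes idle. *)
Definition walk_step : prog :=
  PWhen (BNot (bpos (nvar DONE)))
    (PNSet REP (nvar CU) (NAdd (nvar CX) (NConst 1)) ;;
     PIf (beq (nvar CU) (nvar SV))
       (nscalar DONE (NConst 1))
       (nscalar CX (NGet PARX (nvar CU)) ;; nscalar CU (NGet PARU (nvar CU)))).

Definition walk : prog :=
  nscalar CU (NGet PARU (nvar SV)) ;;
  nscalar CX (NGet PARX (nvar SV)) ;;
  nscalar DONE (NConst 0) ;;
  PFor LV walk_step.

Definition weigh (a : nat) (b : bexp) : prog :=
  rscalar a RZero ;;
  PFor ZV (PWhen b (rscalar a (RAdd (rvar a) (RWeight (nvar ZV))))).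

Definition pick_step : prog :=
  PWhen (BNot (bpos (NGet TRIED (nvar XV))))
    (weigh GAIN (BAnd (BNot (bpos (NGet COV (nvar ZV))))
                      (BLeR (RDist (nvar XV) (nvar ZV)) (rvar RR))) ;;
     PWhen (bor (BNot (bpos (nvar HAS))) (BNot (BLeR (rvar GAIN) (rvar BEST))))
       (nscalar HAS (NConst 1) ;;
        nscalar SV (nvar XV) ;;
        rscalar BEST (rvar GAIN))).

Definition pick : prog := nscalar HAS (NConst 0) ;; PFor XV pick_step.

Definition cover : prog :=
  PFor ZV (PWhen (BLeR (RDist (nvar SV) (nvar ZV))
                       (RAdd (RAdd (rvar RR) (rvar RR)) (rvar RR)))
             (PNSet COV (nvar ZV) (NConst 1))).

Definition greedy_round : prog :=
  pick ;;
  PWhen (bpos (nvar HAS))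
    (search ;;
     PWhen (bpos (NGet MARK (nvar SV))) (walk ;; cover) ;;
     PNSet TRIED (nvar SV) (NConst 1)).

Definition greedy : prog :=
  clear REP ;; clear COV ;; clear TRIED ;; PFor RV greedy_round.

Definition quintuple (e : rexp) : rexp := RAdd (RAdd (RAdd (RAdd e e) e) e) e.

(** The guard [BLeN (NConst 0) (NConst 0)] always holds, so [collect] outputs all representatives;
    these, and not the greedy set itself, form an independent set. *)
Definition try_radius : prog :=
  rscalar RR (RDist (nvar IV) (nvar JV)) ;;
  greedy ;;
  weigh TOTAL (bpos (NGet COV (nvar ZV))) ;;
  PWhen (BAnd (BLeR RTarget (rvar TOTAL))
              (bor (BNot (bpos (nvar FOUND)))
                   (BLeR (quintuple (rvar RR)) (rvar OUTR))))
    (nscalar FOUND (NConst 1) ;;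
     rscalar OUTR (quintuple (rvar RR)) ;;
     collect OUT (BLeN (NConst 0) (NConst 0))).

Definition robust_center : prog := PFor IV (PFor JV try_radius).

(** * Correctness *)

Section Correctness.
Variables (R : realType) (P : rmc_instance R).
Implicit Types (s t : state R) (f g : points P -> option (points P)).
Implicit Types (u v x y z : points P) (A T : {set points P}).

Let I := indep P.
Local Notation n := #|points P|.
Local Notation den := (den P).
Local Notation nr := (@nr R P).

Lemma beq_eval s e1 e2 : beval P s (beq e1 e2) = (neval P s e1 == neval P s e2).
Proof. by rewrite /= -eqn_leq. Qed.

Lemma bor_eval s b1 b2 : beval P s (bor b1 b2) = beval P s b1 || beval P s b2.
Proof. by rewrite /= -negb_or negbK. Qed.

Lemma band_eval s b1 b2 : beval P s (BAnd b1 b2) = beval P s b1 && beval P s b2.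
Proof. by []. Qed.

Lemma bler_eval s e1 e2 : beval P s (BLeR e1 e2) = (reval P s e1 <= reval P s e2).
Proof. by []. Qed.

Lemma bnot_eval s b : beval P s (BNot b) = ~~ beval P s b.
Proof. by []. Qed.

Lemma den_seq p q s : den (p ;; q) s = den q (den p s).
Proof. by []. Qed.

Lemma den_when b p s : den (PWhen b p) s = if beval P s b then den p s else s.
Proof. by []. Qed.

Lemma den_if b p q s :
  den (PIf b p q) s = if beval P s b then den p s else den q s.
Proof. by []. Qed.

Lemma den_nset a e1 e2 s :
  den (PNSet a e1 e2) s = setn s a (neval P s e1) (neval P s e2).
Proof. by []. Qed.

Lemma den_rset a e1 e2 s :
  den (PRSet a e1 e2) s = setr s a (neval P s e1) (reval P s e2).
Proof. by []. Qed.

Definition encodes s f : Prop :=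
  forall u, nmem s REP (nr u) = if f u is Some x then (nr x).+1 else 0.

Definition vset s a : {set points P} := array_set P (nmem s a).

Lemma in_vset s a x : (x \in vset s a) = (nmem s a (nr x) != 0)%N.
Proof. by rewrite inE. Qed.

Lemma clear_spec (a : nat) s x : a != ZV -> nmem (den (clear a) s) a (nr x) = 0%N.
Proof.
move=> az; suff: forall y, y \in setT -> nmem (den (clear a) s) a (nr y) = 0%N.
  by apply; rewrite inE.
apply: (@den_for _ _ (fun A t => forall y, y \in A -> nmem t a (nr y) = 0%N)).
- by rewrite /= inE eq_sym.
- by move=> y; rewrite inE.
move=> A y t yA tz _ _ IH z; rewrite !inE den_nset nmem_setn //.
by rewrite /= /update eqxx tz eq_nr /=; case: eqP => //= _ /IH.
Qed.

Lemma collect_spec (a : nat) (b : bexp) (Q : pred (points P)) f s :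
  a != ZV -> a != REP -> encodes s f ->
  (forall t u, nmem t ZV 0 = nr u ->
    (forall c : nat, c \notin [:: ZV; a] -> nmem t c = nmem s c) ->
    beval P t b = Q u) ->
  vset (den (collect a b) s) a = rimg f [set u | Q u].
Proof.
move=> az ar sf Qb; rewrite /collect den_seq.
set s1 := den (clear a) s.
have fr1 c : c \notin [:: ZV; a] -> nmem s1 c = nmem s c.
  by move=> ca; rewrite /s1 nmem_den.
have s10 x : nmem s1 a (nr x) = 0%N by apply: clear_spec.
rewrite -[[set u | Q u]]setTI.
apply: (@den_for _ _ (fun A t => vset t a = rimg f (A :&: [set u | Q u]))).
- by rewrite /= inE eq_sym.
- apply/setP => x; rewrite in_vset nmem_setn // s10 eqxx; apply/esym/rimgP.
  by case=> u; rewrite !inE.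
move=> A u t uA tu fr _ IH; rewrite den_when.
have frs c : c \notin [:: ZV; a] -> nmem t c = nmem s c.
  by move=> ca; rewrite fr ?fr1 //; move: ca; rewrite !inE.
have tR : nmem t REP = nmem s REP by apply: frs; rewrite !inE /= eq_sym.
rewrite /= (Qb t u) // tu tR sf.
case fu: (f u) => [x|] /=; last first.
  apply/setP => y; rewrite in_vset nmem_setn // -in_vset IH.
  apply/rimgP/rimgP => -[w]; rewrite !inE.
    by move=> /andP[wA wQ] fw; exists w; rewrite // !inE wA wQ orbT.
  case/andP => /orP[/eqP->|wA] wQ fw; first by rewrite fu in fw.
  by exists w; rewrite // !inE wA.
case: ifP => uQ; apply/setP => y; rewrite in_vset nmem_setn //; last first.
  rewrite -in_vset IH; apply/rimgP/rimgP => -[w]; rewrite !inE.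
    by move=> /andP[wA wQ] fw; exists w; rewrite // !inE wA wQ orbT.
  case/andP => /orP[/eqP->|wA] wQ fw; first by rewrite uQ in wQ.
  by exists w; rewrite // !inE wA.
rewrite den_nset /= tu tR sf fu subn1 /= /update eqxx eq_nr /=.
case: (eqVneq y x) => [->|yx] /=.
  by apply/esym/rimgP; exists u; rewrite // !inE eqxx.
rewrite -in_vset IH; apply/rimgP/rimgP => -[w]; rewrite !inE.
  by move=> /andP[wA wQ] fw; exists w; rewrite // !inE wA wQ orbT.
case/andP => /orP[/eqP->|wA] wQ fw; last by exists w; rewrite // !inE wA.
by move: fw; rewrite fu => -[xy]; rewrite xy eqxx in yx.
Qed.

Lemma test_spec s f v x : encodes s f ->
  nmem s VV 0 = nr v -> nmem s XV 0 = nr x ->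
  nmem (den test s) FL 0 = addable I f v x.
Proof.
move=> sf sv sx; rewrite /test den_seq.
set s1 := den (collect _ _) s.
have tmp : vset s1 TMP = rimg f (~: [set v]).
  have -> : ~: [set v] = [set u | u != v] by apply/setP => u; rewrite !inE.
  apply: collect_spec => // t u tu fr.
  by rewrite bnot_eval beq_eval /= tu fr // sv eq_nr.
have x1 : nmem s1 XV 0 = nr x by rewrite /s1 nmem_den.
rewrite den_seq den_nset den_when /= /update /= x1.
rewrite lt0n negbK /addable /can_add -tmp in_vset negbK.
case: eqP => //= tmpx; rewrite den_seq den_when den_nset /=.
set T1 := array_set _ _; set T2 := (X in _ = (X \in _) :> nat).
have -> : T1 = T2.
  apply/setP => y; rewrite /T1 inE -/(nr y) /update /= x1 eq_nr.
  by rewrite /T2 in_setU1 in_vset; case: (eqVneq y x).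
by case: ifP => _; rewrite ?den_nset /= /update /=.
Qed.

(** The condition refers to the state before the pass: each vertex is visited once, and its test
    does not depend on marks set meanwhile. *)
Definition labelled f s t A (c : nat) u x : Prop :=
  forall v, let b := [&& v \in A, nmem s MARK (nr v) == 0 & addable I f v x] in
  [/\ nmem t MARK (nr v) = if b then c else nmem s MARK (nr v),
      nmem t PARU (nr v) = if b then nr u else nmem s PARU (nr v) &
      nmem t PARX (nr v) = if b then nr x else nmem s PARX (nr v)].

Lemma label_spec f s u x : encodes s f ->
  nmem s UV 0 = nr u -> nmem s XV 0 = nr x ->
  labelled f s (den label s) setT (nmem s CNT 0) u x.
Proof.
move=> sf su sx; apply: (@den_for _ _ (fun A t => labelled f s t A _ u x)) => //.
  by move=> v; rewrite inE.
move=> A v t vA tv fr _ IH w; rewrite den_when bnot_eval /= tv.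
have [mv _ _] := IH v; rewrite (negbTE vA) /= in mv.
rewrite mv lt0n negbK.
case: eqP => [mv0|mv0]; last first.
  rewrite /= /update /= !inE; case: (eqVneq w v) => [->|//].
  by move/eqP/negbTE: mv0 => ->; case: (IH v) => -> -> ->; rewrite (negbTE vA).
rewrite den_seq; set t1 := den test t.
have t1fr b : b \notin nmods test -> nmem t1 b = nmem t b.
  by move=> bt; rewrite /t1 nmem_den.
have tf : encodes t f by move=> y; rewrite fr.
rewrite den_when /= (test_spec (x := x) tf tv) ?fr // lt0b.
case fv: (addable I f v x); last first.
  rewrite /= /update /= !t1fr // !inE; case: (eqVneq w v) => [->|//].
  by rewrite fv !andbF; case: (IH v) => -> -> ->; rewrite (negbTE vA).
rewrite !den_seq !den_nset /= /update /= !t1fr //.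
rewrite tv !eq_nr (fr CNT) ?(fr UV) ?(fr XV) // su sx !inE.
by case: (eqVneq w v) => [->|//] /=; rewrite mv0 fv.
Qed.

(** * The exchange search and the walk back to its root *)

Section Search.
Variables (f : points P -> option (points P)) (sv : points P) (r : R).
Local Notation N := (@near R P (r + r)).
Local Notation marked t := (vset t MARK).

Definition search_env t : Prop :=
  [/\ encodes t f, nmem t SV 0 = nr sv & rmem t RR 0 = r].

(* MARK holds the time at which a vertex was reached, PARU and PARX the edge
   through which this happened; all vertices that can give way to the same [x]
   are reached at the latest when [x] is scanned for the first time. *)
Definition search_inv t : Prop :=
  (forall v, nmem t MARK (nr v) <= nmem t CNT 0)%N /\
  forall v, (0 < nmem t MARK (nr v))%N ->
  exists u x, [/\ nmem t PARU (nr v) = nr u, nmem t PARX (nr v) = nr x,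
    N u x /\ addable I f v x,
    u = sv \/ (0 < nmem t MARK (nr u) < nmem t MARK (nr v))%N &
    forall w, addable I f w x ->
      (0 < nmem t MARK (nr w) <= nmem t MARK (nr v))%N].

(** For [T' = T] this is the closure hypothesis of [closed_not_rado]. *)
Definition expands T T' : Prop :=
  forall u x v, u \in sv |: T -> N u x -> addable I f v x -> v \in T'.

Lemma scan_spec t u x : search_env t ->
  nmem t UV 0 = nr u -> nmem t XV 0 = nr x -> search_inv t ->
  [/\ search_inv (den scan t), marked t \subset marked (den scan t) &
    u \in sv |: marked t -> N u x ->
      forall v, addable I f v x -> v \in marked (den scan t)].
Proof.
case=> tf tsv tr tu tx [le_cnt par]; rewrite /scan den_seq den_nset.
set t1 := setn _ _ _ _.
have cnt1 : nmem t1 CNT 0 = (nmem t CNT 0).+1 by rewrite /= addn1.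
rewrite den_when.
have -> : beval P t1 (BAnd (bor (beq (nvar UV) (nvar SV)) (bpos (NGet MARK (nvar UV))))
           (BLeR (RDist (nvar UV) (nvar XV)) (RAdd (rvar RR) (rvar RR)))) =
    (u \in sv |: marked t) && N u x.
  rewrite [LHS]/= -negb_or negbK -eqn_leq.
  rewrite /update /= tu tsv tx tr eq_nr dist_nrE in_setU1 in_vset -lt0n.
  by [].
case: ifP => [/andP[uT Nux]|nux]; last first.
  split.
  - by split=> [v|] //; apply: leq_trans (le_cnt v) _; rewrite cnt1.
  - by [].
  - by move=> uT Nux; rewrite uT Nux in nux.
have lab := label_spec (s := t1) tf tu tx.
set t2 := den label t1 in lab *.
have cnt2 : nmem t2 CNT 0 = (nmem t CNT 0).+1 by rewrite -cnt1 /t2 nmem_den.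
have M v : nmem t2 MARK (nr v) =
    if (nmem t MARK (nr v) == 0%N) && addable I f v x then (nmem t CNT 0).+1
    else nmem t MARK (nr v).
  by have [-> _ _] := lab v; rewrite inE cnt1.
have Mpos v : (0 < nmem t MARK (nr v))%N ->
    [/\ nmem t2 MARK (nr v) = nmem t MARK (nr v),
        nmem t2 PARU (nr v) = nmem t PARU (nr v) &
        nmem t2 PARX (nr v) = nmem t PARX (nr v)].
  rewrite lt0n => /negbTE mv.
  by have [-> -> ->] := lab v; rewrite /= /update /= mv andbF.
(* After the scan every vertex that can give way to [x] is marked, with at most the current time;
   for the vertices marked just now this is the last clause of the invariant. *)
have Mx v : addable I f v x -> (0 < nmem t2 MARK (nr v) <= (nmem t CNT 0).+1)%N.
  move=> fv; rewrite M fv andbT; case: eqP => [_|/eqP]; first by rewrite leqnn.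
  by rewrite -lt0n => -> /=; apply: leqW.
split; last by move=> _ _ v /Mx/andP[mv _]; rewrite in_vset -lt0n.
  split=> v.
    by rewrite M cnt2; case: ifP => // _; apply: leqW.
  case: (posnP (nmem t MARK (nr v))) => [mv0|mv _].
    rewrite {1}M mv0 eqxx /=; case: ifP => // fv _.
    have [Ev Eu Ex] := lab v; rewrite inE /= /update /= mv0 fv /= in Ev Eu Ex.
    exists u, x; split; [exact: Eu|exact: Ex|by []| |].
      move: uT; rewrite in_setU1 in_vset -lt0n => /orP[/eqP|mu]; first by left.
      by right; have [-> _ _] := Mpos u mu; rewrite mu Ev addn1 ltnS le_cnt.
    by move=> w /Mx; rewrite Ev addn1.
  have [Ev Eu Ex] := Mpos v mv.
  have [w [y [pu px Nwy lt_wv first_y]]] := par v mv.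
  exists w, y; rewrite Ev Eu Ex; split=> //.
    case: lt_wv => [->|/andP[mw lt_wv]]; first by left.
    by right; have [-> _ _] := Mpos w mw; rewrite mw.
  by move=> z /first_y /andP[mz ?]; have [-> _ _] := Mpos z mz; rewrite mz.
apply/subsetP => v; rewrite !in_vset -!lt0n => mv.
by have [-> _ _] := Mpos v mv.
Qed.

Lemma scan_row_spec t u : search_env t -> nmem t UV 0 = nr u -> search_inv t ->
  [/\ search_inv (den (PFor XV scan) t),
    marked t \subset marked (den (PFor XV scan) t) &
    u \in sv |: marked t -> forall x v, N u x -> addable I f v x ->
      v \in marked (den (PFor XV scan) t)].
Proof.
case=> tf tsv tr tu tI.
have := @den_for _ _ (fun A t' => [/\ search_inv t', marked t \subset marked t' &
    u \in sv |: marked t -> forall x v, x \in A -> N u x -> addable I f v x ->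
      v \in marked t']) XV scan t isT.
case=> [|A x t' xA tx fr frr [t'I tt' t'A]|tI' tt' ex]; last first.
- by split=> // uT x v; apply: ex; rewrite // inE.
- have env' : search_env t'.
    by split=> [y||]; rewrite ?fr ?frr //; apply: tf.
  have [] := scan_spec env' _ tx t'I (u := u); first by rewrite fr.
  move=> t2I sub2 ex2; split=> //; first exact: subset_trans tt' sub2.
  move=> uT y v /setU1P[->|yA] Nuy fv; last first.
    by apply: (subsetP sub2); apply: t'A Nuy fv.
  by apply: ex2 => //; apply: subsetP uT; apply: setUS.
- by split=> // _ x v; rewrite inE.
Qed.

Lemma search_round_spec t : search_env t -> search_inv t ->
  [/\ search_inv (den (PFor UV (PFor XV scan)) t),
    marked t \subset marked (den (PFor UV (PFor XV scan)) t) &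
    expands (marked t) (marked (den (PFor UV (PFor XV scan)) t))].
Proof.
case=> tf tsv tr tI.
have := @den_for _ _ (fun A t' => [/\ search_inv t', marked t \subset marked t' &
    forall u x v, u \in A -> u \in sv |: marked t -> N u x -> addable I f v x ->
      v \in marked t']) UV (PFor XV scan) t isT.
case=> [|A u t' uA tu fr frr [t'I tt' t'A]|tI' tt' ex]; last first.
- by split=> // u x v; apply: ex; rewrite // inE.
- have env' : search_env t'.
    by split=> [y||]; rewrite ?fr ?frr //; apply: tf.
  have [] := scan_row_spec env' tu t'I.
  move=> t2I sub2 ex2; split=> //; first exact: subset_trans tt' sub2.
  move=> w y v /setU1P[->|wA] wT Nwy fv; last first.
    by apply: (subsetP sub2); apply: t'A Nwy fv.
  by apply: ex2 Nwy fv; apply: subsetP wT; apply: setUS.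
- by split=> // u x v; rewrite inE.
Qed.

Lemma search_spec t : search_env t ->
  search_inv (den search t) /\
  (sv \notin marked (den search t) ->
    exists2 T : {set points P}, sv \notin T & expands T T).
Proof.
case=> tf tsv tr; rewrite /search !den_seq.
set t1 := den (clear MARK) t.
set t2 := den (nscalar CNT _) t1.
have M0 v : nmem t1 MARK (nr v) = 0%N by apply: clear_spec.
have fr2 b : b \notin [:: ZV; MARK; CNT] -> nmem t2 b = nmem t b.
  rewrite !inE !negb_or => /and3P[bz bm bc].
  by rewrite /t2 /t1 !nmem_den // !inE ?negb_or ?bz.
have frr2 b : rmem t2 b = rmem t b by rewrite /t2 /t1 !rmem_den.
(* Each round marks a new vertex or finds the marked set closed. Hence after one round per point
   either a closed set has occurred or everything is marked, the root included. *)
have := @den_for _ _ (fun A t' => search_inv t' /\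
    ((exists2 T : {set points P}, T \subset marked t' & expands T T) \/
     (#|A| <= #|marked t'|)%N)) LV (PFor UV (PFor XV scan)) t2 isT.
case=> [|A u t' uA tu fr frr [t'I t'A]|tI' [[T sT eT]|leT]].
- split; last by right; rewrite cards0.
  by split=> v; rewrite /= /update /= M0.
- have env' : search_env t'.
    by split=> [y||]; rewrite ?fr ?frr ?frr2 ?fr2 //; apply: tf.
  have [t2I sub2 ex2] := search_round_spec env' t'I; split=> //.
  case: t'A => [[T sT eT]|leA].
    by left; exists T => //; apply: subset_trans sT sub2.
  have [E|/subsetPn[w w2 w1]] :=
    boolP (marked (den (PFor UV (PFor XV scan)) t') \subset marked t').
    left; exists (marked t') => // w x v wT Nwx fv.
    exact/(subsetP E)/(ex2 w x).
  right; rewrite cardsU1 uA add1n; apply: leq_ltn_trans leA _.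
  by apply: proper_card; apply/properP; split=> //; exists w.
- by split=> // nsv; exists T => //; apply: contra nsv; apply: subsetP.
split=> // /negP[].
suff /eqP -> : marked (den (PFor LV (PFor UV (PFor XV scan))) t2) == setT.
  by rewrite inE.
by rewrite eqEcard subsetT.
Qed.

Lemma encodes_assign t g u x :
  encodes t g -> encodes (setn t REP (nr u) (nr x).+1) (assign g u x).
Proof.
move=> tg v; rewrite /= /update /= eq_nr /assign.
by case: (eqVneq v u).
Qed.

(** Following parents from the root, each point receives the element through which its child was
    reached. [search_exchange] shows that the element it gives way to can be placed next. *)
Lemma walk_spec s : is_sdr I N f -> sv \notin dom f ->
  search_env s -> search_inv s -> sv \in marked s ->
  exists g, [/\ encodes (den walk s) g, is_sdr I N g & dom g = sv |: dom f].
Proof.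
move=> sf svd [ef esv er] [_ par]; rewrite in_vset -lt0n => msv.
have matI := indep_matroid P.
pose m v := nmem s MARK (nr v).
(* The vertices marked no later than [u] still carry their representatives from [f] when the walk is
   at [u]. They become strictly fewer at each step, and none are left once the walk is back at
   [sv]. *)
pose active u v := (u != sv) && (0 < m v <= m u)%N.
have [u0 [x0 [pu0 px0 [Nux0 fx0] lt_u0 _]]] := par sv msv.
rewrite /walk !den_seq; set t0 := den _ (den _ (den _ s)).
have fr0 b : b \notin [:: CU; CX; DONE] -> nmem t0 b = nmem s b.
  rewrite !inE !negb_or => /and3P[h1 h2 h3].
  by rewrite /t0 !nmem_den // inE.
have cu0 : nmem t0 CU 0 = nr u0.
  by rewrite /t0 !den_nset /= /update /= esv pu0.
have cx0 : nmem t0 CX 0 = nr x0.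
  by rewrite /t0 !den_nset /= /update /= esv px0.
have lt_usv u : u = sv \/ (0 < m u < m sv)%N -> u != sv -> (0 < m u < m sv)%N.
  by case=> // -> /eqP.
pose Inv (A : {set points P}) t :=
    if nmem t DONE 0 == 0%N then exists g u x,
      [/\ [/\ encodes t g, is_sdr I N g & dom g = dom f],
          [/\ nmem t CU 0 = nr u, nmem t CX 0 = nr x, N u x &
              can_add I (rimg g setT) x],
          u = sv \/ (0 < m u < m sv)%N,
          forall v, active u v -> g v = f v &
          (#|active u| + #|A| < n)%N]
    else exists g, [/\ encodes t g, is_sdr I N g & dom g = sv |: dom f].
(* After one pass per point the unfinished case would require [#|active u| + n < n]. *)
suff: Inv setT (den (PFor LV walk_step) t0).
  rewrite /Inv; case: ifP => // _ [g [u [x [_ _ _ _]]]].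
  by rewrite cardsT ltnNge leq_addl.
apply: (@den_for _ _ Inv) => [||A w t wA tw fr frr IH] //.
- rewrite /Inv; exists f, u0, x0; split=> //.
  (* As [sv] has no representative yet, [addable f sv x0] already concerns the whole image. *)
  + by split=> //; rewrite -(rimg_notin svd).
  + rewrite cards0 addn0; apply: (@leq_trans #|[set v : points P | true]|); last first.
      by rewrite max_card.
    apply: proper_card; apply/properP; split.
      by apply/subsetP => v; rewrite inE.
    exists sv; rewrite ?inE // unfold_in /active.
    apply/negP => /andP[/(lt_usv _ lt_u0)/andP[_]].
    by rewrite ltnNge => /negbTE -> /andP[].
- rewrite den_when bnot_eval /= -leqNgt leqn0.
  rewrite {1}/Inv in IH.
  case: eqP IH => [t0D [g [u [x [[tg sg dg] [tu tx Nux gx] lt_u agree lt_n]]]]|t0D].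
    rewrite den_seq den_nset /= tu tx addn1 den_if beq_eval /=.
    rewrite {1 2}/update /= tu fr // fr0 // esv eq_nr.
    have tg' := encodes_assign u x tg.
    have sg' : is_sdr I N (assign g u x).
      by apply: sdr_assign => //; apply: addable_sub.
    have [usv|usv] := eqVneq u sv.
      rewrite /Inv /= /update /=; exists (assign g u x); split=> //.
      by rewrite dom_assign dg usv.
    have /andP[mu lt_usv'] := lt_usv u lt_u usv.
    have [u' [z [pu pz [Nuz fz] lt_u' first_z]]] := par u mu.
    have agree' v : (0 < m v <= m u)%N -> g v = f v.
      by move=> mv; apply: agree; rewrite /active usv.
    have [ud gz] := search_exchange matI sf sg svd lt_usv' fz first_z agree' gx.
    have lt_u'sv : u' = sv \/ (0 < m u' < m sv)%N.
      case: lt_u' => [|/andP[mu' lt']]; [by left|right].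
      by rewrite mu' (ltn_trans lt').
    rewrite den_seq !den_nset /Inv /= /update /= tu t0D /=.
    rewrite (fr PARX) // (fr PARU) // !fr0 // pu pz.
    exists (assign g u x), u', z; split=> //.
    + split=> //.
      by rewrite dom_assign dg; apply/setUidPr; rewrite sub1set.
    + move=> v /andP[u'sv /andP[mv le_v]].
      have /andP[_ lt_u'u] : (0 < m u' < m u)%N.
        by case: lt_u' => // E; rewrite E eqxx in u'sv.
      rewrite /assign; case: eqVneq => [E|_].
        by move: (leq_ltn_trans le_v lt_u'u); rewrite E ltnn.
      by apply: agree'; rewrite mv (leq_trans le_v) // ltnW.
    rewrite cardsU1 wA add1n addnS -addSn; apply: leq_ltn_trans lt_n.
    rewrite leq_add2r; apply: proper_card; apply/properP; split.
      apply/subsetP => v; rewrite !unfold_in /active usv.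
      move=> /andP[u'sv /andP[-> le_v]] /=.
      case: lt_u' => [E|/andP[_ lt_u'u]]; first by rewrite E eqxx in u'sv.
      by apply: leq_trans le_v (ltnW lt_u'u).
    exists u; rewrite unfold_in /active ?usv ?mu ?leqnn //.
    apply/negP => /andP[u'sv /andP[_]].
    case: lt_u' => [E|/andP[_ lt_u'u]]; first by rewrite E eqxx in u'sv.
    by rewrite leqNgt lt_u'u.
  rewrite /Inv /= /update /=; move/eqP/negbTE: t0D => ->.
  by case=> g [tg sg dg]; exists g.
Qed.

End Search.

Lemma set_weightU1 A T x : x \notin A ->
  set_weight ((x |: A) :&: T) =
  set_weight (A :&: T) + (if x \in T then weight x else 0).
Proof.
move=> xA; rewrite setIUl /set_weight.
case: ifP => xT; last first.
  rewrite addr0 (_ : [set x] :&: T = set0) ?set0U //.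
  by apply/setP => y; rewrite !inE; case: eqP => // ->.
have -> : [set x] :&: T = [set x] by apply/setIidPl; rewrite sub1set.
have xAT : x \notin A :&: T by rewrite in_setI (negbTE xA).
rewrite (big_setU1 _ xAT) /=.
exact: addrC.
Qed.

Lemma weigh_spec (a : nat) b (Q : pred (points P)) s :
  (forall t u, nmem t ZV 0 = nr u ->
    (forall c : nat, c != ZV -> nmem t c = nmem s c) ->
    (forall c : nat, c != a -> rmem t c = rmem s c) -> beval P t b = Q u) ->
  rmem (den (weigh a b) s) a 0 = set_weight [set u | Q u].
Proof.
move=> Qb; rewrite /weigh den_seq den_rset.
set s1 := setr _ _ _ _; rewrite -[[set u | Q u]]setTI.
have frr1 c : c != a -> rmem s1 c = rmem s c by move=> ca; apply: rmem_setr.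
apply: (@den_for _ _ (fun A t => rmem t a 0 = set_weight (A :&: [set u | Q u]))).
- by [].
- by rewrite set0I /set_weight big_set0 /= /update !eqxx.
move=> A u t uA tu fr frr IH; rewrite /= den_when (Qb t u) //.
- rewrite set_weightU1 // inE; case: ifP => _; last by rewrite addr0.
  by rewrite den_rset /= /update !eqxx /= tu weight_nrE IH.
- by move=> c cz; rewrite fr ?inE.
- by move=> c ca; rewrite frr ?frr1 // inE.
Qed.

(** * Correctness of the greedy algorithm for a fixed radius *)

Section Greedy.
Variable r : R.
Hypothesis r_ge0 : 0 <= r.
Local Notation N := (@near R P (r + r)).
Local Notation tried t := (vset t TRIED).
Local Notation covered t := (vset t COV).

Lemma pick_spec s : rmem s RR 0 = r ->
  if nmem (den pick s) HAS 0 == 0%N then forall x, x \in tried s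
  else exists v, [/\ nmem (den pick s) SV 0 = nr v, v \notin tried s &
    forall x, x \notin tried s -> gain r (covered s) x <= gain r (covered s) v].
Proof.
move=> sr; rewrite /pick den_seq; set s1 := den _ s.
have fr1 b : b != HAS -> nmem s1 b = nmem s b.
  by move=> bh; rewrite /s1 nmem_den // inE.
have s1r : rmem s1 RR 0 = r by rewrite /s1 rmem_den.
pose Inv (A : {set points P}) t :=
  if nmem t HAS 0 == 0%N then forall x, x \in A -> x \in tried s
  else exists v, [/\ nmem t SV 0 = nr v, v \notin tried s,
    rmem t BEST 0 = gain r (covered s) v &
    forall x, x \in A -> x \notin tried s ->
      gain r (covered s) x <= gain r (covered s) v].
suff: Inv setT (den (PFor XV pick_step) s1).
  rewrite /Inv; case: ifP => _ => [all_tried x|[v [tv vT _ maxv]]].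
    by apply: all_tried; rewrite inE.
  by exists v; split=> // x; apply: maxv; rewrite inE.
apply: (@den_for _ _ Inv) => [||A x t xA tx fr frr IH] //.
  by move=> x; rewrite inE.
have tT : (0 < nmem t TRIED (nr x))%N = (x \in tried s).
  by rewrite in_vset fr // fr1 // lt0n.
rewrite den_when bnot_eval /= tx tT; case: (boolP (x \in tried s)) => xT /=.
  move: IH; rewrite /Inv /= /update /=; case: ifP => _.
    by move=> IH y /setU1P[->//|]; apply: IH.
  case=> v [tv vT bestv maxv]; exists v; split=> // y /setU1P[->|]; last exact: maxv.
  by rewrite xT.
rewrite den_seq; set t1 := den (weigh _ _) t.
have gain1 : rmem t1 GAIN 0 = gain r (covered s) x.
  rewrite /t1 (@weigh_spec _ _ (fun y => (y \notin covered s) && (dist x y <= r))).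
    congr set_weight; apply/setP => y; rewrite inE.
    by rewrite !inE.
  move=> t' y ty fr' frr' /=.
  rewrite ty (fr' COV) // (fr COV) // (fr1 COV) // (fr' XV) // tx dist_nrE.
  by rewrite frr' // frr // s1r in_vset lt0n.
have fr1t b : b != ZV -> nmem t1 b = nmem t b.
  by move=> bz; rewrite /t1 nmem_den // inE.
have best1 : rmem t1 BEST = rmem t BEST by rewrite /t1 rmem_den.
rewrite den_when bor_eval !bnot_eval /= gain1 best1 fr1t // -leqNgt leqn0 -ltNge.
move: IH; rewrite {1}/Inv; case: eqP => [_ IH|/eqP hast] /=.
  rewrite !den_seq !den_nset den_rset /Inv /= /update /= gain1.
  exists x; split=> //; first by rewrite fr1t.
  by move=> y /setU1P[->//|yA]; rewrite IH.
case=> v [tv vT bestv maxv]; rewrite bestv; case: ltP => lt_v.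
  rewrite !den_seq !den_nset den_rset /Inv /= /update /= gain1.
  exists x; split=> //; first by rewrite fr1t.
  move=> y /setU1P[->//|yA] yT; apply: le_trans (maxv y yA yT) (ltW lt_v).
rewrite /Inv /= /update /= !fr1t // (negbTE hast) best1.
exists v; split=> // y /setU1P[->//|yA]; exact: maxv.
Qed.

Lemma cover_spec s v : nmem s SV 0 = nr v -> rmem s RR 0 = r ->
  covered (den cover s) = covered s :|: cball v (r + r + r).
Proof.
move=> sv sr; rewrite /cover -[cball _ _]setTI.
apply: (@den_for _ _ (fun A t => covered t =
  covered s :|: (A :&: cball v (r + r + r)))) => //.
  by rewrite set0I setU0; apply/setP => x; rewrite !in_vset.
move=> A x t xA tx fr frr IH; rewrite den_when /= tx fr // sv frr // sr dist_nrE.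
apply/setP => y; rewrite setIUl setUCA in_setU -IH in_setI in_set1 !inE -/(nr y).
case: ifP => dx; rewrite ?den_nset /= /update /= ?tx ?eq_nr.
  by case: (eqVneq y x) => [->|//]; rewrite dx.
by case: (eqVneq y x) => [->|//]; rewrite dx.
Qed.

(** The greedy set is [dom f]. The set [C] belongs to the analysis and is never computed: it starts
    as [C0] and shrinks as points are added. *)
Definition greedy_inv t : Prop := exists f,
  [/\ [/\ encodes t f, is_sdr I N f & dom f \subset tried t],
      forall x, x \in tried t -> x \notin dom f -> ~ rado I N (x |: dom f),
      covered t = cballs (dom f) (r + r + r) &
      forall C0, C0 \in I -> exists2 C, mixed I N (dom f) C &
        set_weight (cballs C0 r) <= set_weight (covered t :|: cballs C r)].

Lemma sub_cballs (C : {set points P}) (a b : R) :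
  a <= b -> cballs C a \subset cballs C b.
Proof.
move=> ab; apply/subsetP => x /cballsP[u uC du]; apply/cballsP.
by exists u => //; apply: le_trans ab.
Qed.

Lemma cballsU1 (C : {set points P}) u (a : R) :
  cballs (u |: C) a = cball u a :|: cballs C a.
Proof. by rewrite /cballs bigcup_setU big_set1. Qed.

Lemma greedy_round_spec t : rmem t RR 0 = r -> greedy_inv t ->
  greedy_inv (den greedy_round t) /\
  (tried (den greedy_round t) = setT \/
   (#|tried t| < #|tried (den greedy_round t)|)%N).
Proof.
move=> tr [f [[tf sf sft] bad covt invt]]; have matI := indep_matroid P.
have tI : greedy_inv t by exists f.
rewrite /greedy_round den_seq den_when.
have := pick_spec tr; set t1 := den pick t.
have fr1 b : b \notin nmods pick -> nmem t1 b = nmem t b.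
  by move=> bp; rewrite /t1 nmem_den.
have vset1 b : b \notin nmods pick -> vset t1 b = vset t b.
  by move=> bp; rewrite /vset fr1.
have t1I : greedy_inv t1.
  exists f; rewrite !vset1 //; split=> //; split=> // v.
  by rewrite fr1.
case: eqP => [has|/eqP]; last rewrite -lt0n => has.
  rewrite /= has => all_tried; split=> //; left.
  by rewrite vset1 //; apply/setP => x; rewrite all_tried inE.
case=> s [t1s sT maxs]; rewrite /= has.
have sd : s \notin dom f by apply: contra sT; apply: (subsetP sft).
have env1 : search_env f s r t1.
  by split; rewrite // ?/t1 ?rmem_den // => v; rewrite fr1.
rewrite den_seq; set t2 := den search t1.
have [sI closed] : search_inv f s r t2 /\ _ := search_spec env1.
have fr2 b : b \notin nmods search -> nmem t2 b = nmem t1 b.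
  by move=> bp; rewrite /t2 nmem_den.
have env2 : search_env f s r t2.
  case: env1 => e1 e2 e3.
  by split; rewrite ?fr2 // /t2 ?rmem_den // => v; rewrite nmem_den.
have [t2f t2s t2r] := env2.
rewrite den_seq den_nset den_when.
have -> : beval P t2 (bpos (NGet MARK (nvar SV))) = (s \in vset t2 MARK).
  by rewrite /= t2s in_vset lt0n.
have vset2 b : b \notin nmods search -> b \notin nmods pick -> vset t2 b = vset t b.
  by move=> bs bp; rewrite /vset fr2 ?fr1.
have triedE t3 : nmem t3 TRIED = nmem t2 TRIED -> nmem t3 SV = nmem t2 SV ->
    tried (setn t3 TRIED (neval P t3 (nvar SV)) (neval P t3 (NConst 1))) =
    s |: tried t.
  move=> e1 e2; apply/setP => x; rewrite in_setU1 -[tried t]vset2 // !in_vset.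
  by rewrite /= /update /= e1 e2 t2s eq_nr; case: (eqVneq x s).
have ltT : (#|tried t| < #|s |: tried t|)%N by rewrite cardsU1 sT.
case: ifP => [smark|/negbT nmark]; last first.
  rewrite triedE //; split; last by right.
  (* The search did not return to [s], so its closed set certifies the rejection. *)
  have [T sT' expT] := closed nmark.
  have nrado : ~ rado I N (s |: dom f).
    by apply: (closed_not_rado matI sf sd sT'); apply: expT.
  exists f; rewrite triedE //; split.
  - by split=> //; apply: subset_trans sft (subsetUr _ _).
  - by move=> x /setU1P[->//|]; apply: bad.
  - by rewrite -covt -(vset2 COV).
  - by rewrite -[vset _ COV]/(vset t2 COV) vset2.
rewrite den_seq; set t3 := den walk t2; set t4 := den cover t3.
have fr3 b : b \notin nmods walk -> nmem t3 b = nmem t2 b.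
  by move=> bp; rewrite /t3 nmem_den.
have fr4 b : b \notin nmods cover -> nmem t4 b = nmem t3 b.
  by move=> bp; rewrite /t4 nmem_den.
have e1 : nmem t4 TRIED = nmem t2 TRIED by rewrite fr4 ?fr3.
have e2 : nmem t4 SV = nmem t2 SV by rewrite fr4 ?fr3.
rewrite triedE //; split; last by right.
have [g [t3g sg dg]] := walk_spec sf sd env2 sI smark.
have t4cov : covered t4 = covered t :|: cball s (r + r + r).
  rewrite /t4 (@cover_spec _ s) ?fr3 //; last by rewrite /t3 rmem_den.
  by rewrite /vset fr3 // -/(vset t2 COV) vset2.
exists g; rewrite triedE // dg; split.
- split=> //; last by apply: setUS.
  by move=> v; rewrite /= /update /= fr4.
- move=> x /setU1P[->|xT]; first by rewrite setU11.
  rewrite in_setU1 negb_or => /andP[xs xd] xrado.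
  (* Rado independence is hereditary, so a rejection stays valid as the greedy set grows. *)
  apply: (bad x xT xd); apply: (radoS matI) xrado.
  by rewrite setUS // subsetUr.
- by rewrite -[vset _ COV]/(vset t4 COV) t4cov covt cballsU1 setUC.
move=> C0 /invt[C mC leC]; rewrite -[vset _ COV]/(vset t4 COV) t4cov.
(* A point that extends [dom f] cannot have been tried, as [bad] would exclude it, so [pick]
   compared it with [s]. *)
have [|//||//|c cd crado|C' mC' leC'] :=
  @greedy_step R P r r_ge0 (dom f) (covered t) C s.
- by rewrite covt; apply: sub_cballs; rewrite lerDr addr_ge0.
- by exists g.
- by apply: maxs; apply/negP => cT; apply: bad crado.
by exists C' => //; apply: le_trans leC leC'.
Qed.

Lemma greedy_spec s : rmem s RR 0 = r ->
  exists f, [/\ encodes (den greedy s) f, is_sdr I N f,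
    covered (den greedy s) = cballs (dom f) (r + r + r) &
    forall C, C \in I ->
      set_weight (cballs C r) <= set_weight (covered (den greedy s))].
Proof.
move=> sr; rewrite /greedy !den_seq; set s1 := den (clear TRIED) _.
have matI := indep_matroid P.
have s1r : rmem s1 RR 0 = r by rewrite /s1 !rmem_den.
have s1rep : encodes s1 (fun=> None).
  by move=> u; rewrite /s1 2?nmem_den // clear_spec.
have s1cov : covered s1 = set0.
  by apply/setP => x; rewrite in_vset /s1 nmem_den // clear_spec // inE.
have s1tried : tried s1 = set0.
  by apply/setP => x; rewrite in_vset clear_spec // inE.
have dom0 : dom (fun=> None : option (points P)) = set0.
  by apply/setP => x; rewrite !inE.
have rimg0 : rimg (fun=> None : option (points P)) setT = set0.
  by apply/setP => x; rewrite [RHS]inE; apply/rimgP => -[].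
have sdr0 : is_sdr I N (fun=> None).
  by split=> //; rewrite rimg0; case: matI.
have s1I : greedy_inv s1.
  exists (fun=> None); rewrite dom0 s1cov s1tried sub0set; split=> //.
  - by move=> x; rewrite inE.
  - by rewrite /cballs big_set0.
  move=> C0 C0I; exists C0; last by rewrite set0U.
  exists (fun=> None); rewrite dom0 rimg0 set0U; split=> //.
  by rewrite -setI_eq0 set0I.
pose Inv (A : {set points P}) t :=
  greedy_inv t /\ (tried t = setT \/ (#|A| <= #|tried t|)%N).
suff [[f [[tf sf sft] bad covt invt]] triedT] : Inv setT (den (PFor RV greedy_round) s1).
  have {}triedT : tried (den (PFor RV greedy_round) s1) = setT.
    case: triedT => // leT; apply/eqP; rewrite eqEcard subsetT //.
  exists f; split=> // C /invt[C' mC' leC]; apply: le_trans leC _.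
  apply: set_weightS; rewrite subUset subxx covt.
  apply: (@subset_trans _ _ (cballs (dom f) r)); last first.
    by apply: sub_cballs; rewrite lerDr addr_ge0.
  apply/subsetP => x /cballsP[c cC dcx]; apply/cballsP; exists c => //.
  (* All points have been tried, so a [c] outside [dom f] was rejected, while [mixed_rado] shows
     that it extends [dom f]. Thus the balls of [C'] are already covered. *)
  apply/negPn/negP => cd; apply: (bad c) => //; first by rewrite triedT inE.
  by apply: mixed_rado mC' cC _ => //; rewrite /near distxx addr_ge0.
apply: (@den_for _ _ Inv) => [||A x t xA tx fr frr [tI leA]] //.
  by split=> //; right; rewrite cards0.
have [|gI gT] := greedy_round_spec _ tI; first by rewrite frr.
split=> //; case: gT => [?|ltT]; [by left|right].
case: leA => [tT|leA]; last by rewrite cardsU1 xA add1n (leq_ltn_trans leA).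
by move: ltT; rewrite tT cardsT ltnNge max_card.
Qed.

End Greedy.

(** * Correctness of the loop over candidate radii *)

Definition output_inv (D : points P -> points P -> Prop) t : Prop :=
  if nmem t FOUND 0 == 0%N then rmem t OUTR 0 = 0 /\
    forall x y (C : {set points P}), D x y -> ~ feasible C (dist x y)
  else feasible (vset t OUT) (rmem t OUTR 0) /\
    forall x y (C : {set points P}), D x y -> feasible C (dist x y) ->
      rmem t OUTR 0 <= 5%:R * dist x y.

(** Passing from [u] to its representative costs at most [r + r], on top of the covering radius
    [r + r + r]. *)
Lemma feasible_rimg f (r : R) : 0 <= r -> is_sdr I (@near R P (r + r)) f ->
  target P <= set_weight (cballs (dom f) (r + r + r)) ->
  feasible (rimg f setT) (r + r + r + r + r).
Proof.
move=> r0 [Nf _ fI] le_target; split=> //; first by rewrite !addr_ge0.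
apply: le_trans le_target _; apply: set_weightS.
apply/subsetP => v /cballsP[u]; rewrite inE; case fu: (f u) => [x|] // _ duv.
apply/cballsP; exists x; first by apply/rimgP; exists u.
apply: le_trans (dist_triangle x u v) _; rewrite dist_sym.
have := Nf _ _ fu; rewrite /near => dux.
by apply: le_trans (lerD dux duv) _; rewrite !addrA.
Qed.

(** [D] records the pairs already tried. Since the output is compared with every feasible distance
    among them, the pairs may come in any order. *)
Lemma try_radius_spec D t x y : nmem t IV 0 = nr x -> nmem t JV 0 = nr y ->
  output_inv D t ->
  output_inv (fun x' y' => D x' y' \/ x' = x /\ y' = y) (den try_radius t).
Proof.
move=> tx ty tD; rewrite /try_radius 3!den_seq.
set r := dist x y.
have r0 : 0 <= r by case: (dist_metric P) => + _ _ _; apply.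
set t1 := den (rscalar RR _) t.
have t1r : rmem t1 RR 0 = r.
  by rewrite /t1 den_rset /= /update /= tx ty dist_nrE.
have [f [t2f sf covf optf]] := greedy_spec r0 t1r.
set t2 := den greedy t1 in t2f covf optf *.
set t3 := den (weigh TOTAL _) t2.
have t3w : rmem t3 TOTAL 0 = set_weight (vset t2 COV).
  rewrite /t3 (@weigh_spec _ _ (fun u => u \in vset t2 COV)).
    by congr set_weight; apply/setP => u; rewrite !inE.
  by move=> t' u tu fr _; rewrite /= tu fr // in_vset lt0n.
have fr3 b : b \notin nmods greedy ++ [:: ZV] -> nmem t3 b = nmem t b.
  rewrite mem_cat negb_or => /andP[bg bz].
  by rewrite /t3 nmem_den // /t2 nmem_den.
have frr3 b : b \notin [:: RR; TOTAL] ++ rmods greedy -> rmem t3 b = rmem t b.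
  rewrite mem_cat negb_or => /andP[+ bg]; rewrite !inE negb_or => /andP[br bt].
  by rewrite /t3 rmem_den /= ?inE ?(negbTE bt) // /t2 rmem_den // /t1 rmem_den // inE.
have t3r : rmem t3 RR 0 = r.
  by rewrite /t3 rmem_den // /t2 rmem_den.
have t3f : encodes t3 f by move=> u; rewrite /t3 nmem_den.
have quint t' : rmem t' RR 0 = r -> reval P t' (quintuple (rvar RR)) = 5%:R * r.
  by move=> t'r; rewrite /= t'r; ring.
rewrite den_when.
have -> : beval P t3 (BAnd (BLeR RTarget (rvar TOTAL)) (bor (BNot (bpos (nvar FOUND)))
    (BLeR (quintuple (rvar RR)) (rvar OUTR)))) =
    (target P <= set_weight (vset t2 COV)) &&
    ((nmem t FOUND 0 == 0%N) || (5%:R * r <= rmem t OUTR 0)).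
  rewrite band_eval bor_eval bnot_eval !bler_eval quint //.
  rewrite -t3w /= (fr3 FOUND) // (frr3 OUTR) //.
  by rewrite -leqNgt leqn0.
case: ifP => [/andP[le_w better]|nbetter]; last first.
  (* By [optf] the greedy cover outweighs the [r]-balls of every independent set, so missing the
     target proves [r] infeasible. *)
  have nfeas (C : {set points P}) : feasible C r -> target P <= set_weight (vset t2 COV).
    by case=> _ CI le_C; apply: le_trans le_C (optf _ CI).
  move: tD nbetter; rewrite /output_inv (fr3 FOUND) // (frr3 OUTR) //.
  rewrite /vset (fr3 OUT) //; case: eqP => /= _.
    case=> t0 infeas nw; split=> // x' y' C [Dxy|[-> ->] /nfeas]; first exact: infeas.
    by rewrite andbT in nw; rewrite nw.
  case=> out_feas le_out nw; split=> // x' y' C [Dxy|[-> -> /nfeas Cr]].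
    exact: le_out.
  by move: nw; rewrite Cr => /negbT; rewrite -ltNge => /ltW.
rewrite 2!den_seq; set t4 := den (rscalar OUTR _) _.
have t4o : rmem t4 OUTR 0 = 5%:R * r.
  by rewrite /t4 den_rset -(quint (den (nscalar FOUND (NConst 1)) t3)).
set t5 := den (collect _ _) t4.
have t5o : rmem t5 OUTR 0 = 5%:R * r by rewrite /t5 rmem_den.
have t5c : vset t5 OUT = rimg f setT.
  have <- : [set u : points P | predT u] = setT by apply/setP => u; rewrite !inE.
  exact: collect_spec.
have t5F : nmem t5 FOUND 0 = 1%N by rewrite /t5 nmem_den.
rewrite /output_inv t5F /= t5o t5c; split.
  have -> : 5%:R * r = r + r + r + r + r by ring.
  by apply: feasible_rimg => //; rewrite -covf.
move=> x' y' C [Dxy|[-> ->]//] Cr; move: tD better; rewrite /output_inv.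
case: eqP => /= _; first by case=> _ /(_ _ _ _ Dxy Cr).
by case=> _ /(_ _ _ _ Dxy Cr) le_out /le_trans; apply.
Qed.

Lemma robust_center_spec :
  output_inv (fun _ _ => True) (den robust_center (init_state R)).
Proof.
have weaken (D D' : points P -> points P -> Prop) t :
    (forall x y, D' x y -> D x y) -> output_inv D t -> output_inv D' t.
  move=> DD'; rewrite /output_inv; case: ifP => _ [h1 h2]; split=> // x y C /DD'.
    exact: h2.
  exact: h2.
pose Inv (A : {set points P}) := output_inv (fun x _ => x \in A).
suff : Inv setT (den robust_center (init_state R)).
  by apply: weaken => x y _; rewrite inE.
apply: (@den_for _ _ Inv) => // [|A x t xA tx _ _ IH].
  by split=> // x y C; rewrite inE.
(* The complete rows of the points in [A], and the part [B] of the row of [x]. *)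
pose Inv' (B : {set points P}) :=
  output_inv (fun x' y' => x' \in A \/ x' = x /\ y' \in B).
suff : Inv' setT (den (PFor JV try_radius) t).
  by apply: weaken => x' y' /setU1P[->|?]; [right; rewrite inE|left].
apply: (@den_for _ _ Inv') => // [|B y t' yB ty fr _ IH'].
  by apply: weaken IH => x' y' []// []; rewrite inE.
have := @try_radius_spec _ t' x y _ ty IH'; rewrite fr // => /(_ tx).
apply: weaken => x' y' [?|[-> /setU1P[->|?]]]; first by left; left.
  by right.
by left; right.
Qed.

End Correctness.

(** * Attainment of the optimal radius by a distance, and the approximation guarantee *)

Lemma optimal_radius_exists (R : realType) (P : rmc_instance R) (x0 : points P) C0 r0 :
  @feasible R P C0 r0 ->
  exists (x y : points P) (C : {set points P}),
    optimal_radius P (dist x y) /\ feasible C (dist x y).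
Proof.
pose d (p : points P * points P) := dist p.1 p.2.
pose F p := [exists C in indep P, target P <= set_weight (cballs C (d p))].
have d0 p : 0 <= d p by case: (dist_metric P) => + _ _ _; apply.
have FP p : reflect (exists C : {set points P}, feasible C (d p)) (F p).
  apply: (iffP exists_inP) => -[C]; first by exists C.
  by case=> _ CI le_w; exists C.
(* Lowering [r] to the largest distance not above it removes no point from a ball; [dist x0 x0 = 0]
   ensures that there is such a distance. *)
have round (C : {set points P}) r : feasible C r -> exists2 p, F p & d p <= r.
  case=> r_ge0 CI le_w; have dx0 : d (x0, x0) <= r by rewrite /d /= distxx.
  have [p dp maxp] := @arg_maxP _ R _ (x0, x0) (fun p => d p <= r) d dx0.
  exists p => //; apply/FP; exists C; split=> //; apply: le_trans le_w _.
  apply: set_weightS; apply/subsetP => v /cballsP[u uC duv].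
  by apply/cballsP; exists u => //; apply: (maxp (u, v)).
move=> /round[p1 Fp1 _].
have [p Fp minp] := @arg_minP _ R _ p1 F d Fp1.
have [C Cp] := FP _ Fp; exists p.1, p.2, C; split=> //; split.
  by exists C.
by move=> r' C' /round[p' Fp' le_r']; apply: le_trans le_r'; apply: minp.
Qed.

Theorem theorem1 :
  exists (p : cmd) (c k : nat),
    forall (R : realType) (P : rmc_instance R),
    exists (s : state R) (t : nat),
      [/\ exec P p (init_state R) s t,
          (t <= c * #|points P|.+1 ^ k)%N &
          (exists (C : {set points P}) (r : R), feasible C r) ->
          exists ropt : R,
            [/\ optimal_radius P ropt,
                feasible (out_centers P s) (out_radius s) &
                out_radius s <= 5%:R * ropt]].
Proof.
have [c [k poly]] := @prog_poly robust_center isT.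
exists (compile robust_center), c, k => R P.
have [t run le_t] := poly R P (init_state R).
exists (den P robust_center (init_state R)), t; split=> // -[C0 [r0 feas0]].
have := robust_center_spec P; set s := den _ _ _; rewrite /output_inv.
case: (pickP (fun x : points P => true)) => [x0 _|no_pt].
  have [x [y [C [opt feas]]]] := optimal_radius_exists x0 feas0.
  (* The optimal radius is itself a tried distance, so nothing found would contradict its
     feasibility. *)
  case: eqP => _ [h1 h2]; first by case: (h2 x y C).
  by exists (dist x y); split=> //; apply: h2 feas.
(* Without points the loops make no pass: the output keeps its initial radius 0, which is feasible
   because all sets of points coincide. *)
have all_eq (A B : {set points P}) : A = B.
  by apply/setP => x; have := no_pt x.
have feas0' (A : {set points P}) : feasible A 0.
  case: feas0 => _ CI le_w; rewrite (all_eq A C0); split=> //.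
  by rewrite (all_eq (cballs C0 0) (cballs C0 r0)).
have s0 : out_radius s = 0.
  rewrite /out_radius /s /robust_center /den.
  by have -> : #|points P| = 0%N by apply: eq_card0.
move=> _; exists 0; rewrite s0 mulr0; split=> //.
by split=> [|r C []]; first by exists set0.
Qed.
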